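(* Let $\bar x\in\Gamma$ be a stationary point of (P) and let MSCQ hold at $\bar x$ with modulus $\sigma>0$. Suppose there is $\bar u\in K_\Gamma(\bar x,-\nabla f(\bar x))$ with $\nabla g(\bar x)\bar u\ne0$, let $\bar\lambda$ be the multiplier defined below, and assume that for some $\kappa>0$ $$\big\langle\big(\nabla^2 f(\bar x)+\nabla^2\langle\bar\lambda,g\rangle(\bar x)\big)u,u\big\rangle>\frac1\kappa$$ for all $u\in\mathcal S$ with $\langle\bar\lambda,\nabla g(\bar x)u\rangle=0$ and $\bar\lambda_0\big(\|\nabla g_r(\bar x)u\|^2-(\nabla g_0(\bar x)u)^2\big)=0$. Then $\bar x$ is a tilt-stable local minimizer of (P) with modulus $\kappa$, and $$\mathrm{tilt}(f+\delta_\Gamma,\bar x)\le\sup\Big\{\frac{1}{\langle(\nabla^2 f(\bar x)+\nabla^2\langle\bar\lambda,g\rangle(\bar x))u,u\rangle}\;\Big|\;u\in\mathcal S,\ \langle\bar\lambda,\nabla g(\bar x)u\rangle=0,\ \bar\lambda_0\big(\|\nabla g_r(\bar x)u\|^2-(\nabla g_0(\bar x)u)^2\big)=0\Big\}.$$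
   Context: Setting. Let $n,m\ge1$ and let $\mathcal Q:=\{(q_0,q_r)\in\mathbb R\times\mathbb R^m:\|q_r\|\le q_0\}$ be the second-order cone. For $q=(q_0,q_r)\in\mathbb R^{1+m}$ write $\hat q:=(-q_0,q_r)$, and let $\mathcal Q^*:=\{\hat q: q\in\mathcal Q\}=\{(q_0,q_r):\|q_r\|\le-q_0\}$. The normal cone to $\mathcal Q$ at $q\in\mathcal Q$ is $N_{\mathcal Q}(q)=\mathcal Q^*$ if $q=0$, $N_{\mathcal Q}(q)=\{0\}$ if $q\in\operatorname{int}\mathcal Q$, and $N_{\mathcal Q}(q)=\{\alpha\hat q:\alpha\ge0\}$ if $q\in\operatorname{bd}\mathcal Q\setminus\{0\}$. Problem (P) is: minimize $f(x)$ subject to $x\in\Gamma:=\{x\in\mathbb R^n: g(x)\in\mathcal Q\}$, where $f:\mathbb R^n\to\mathbb R$ and $g=(g_0,g_r):\mathbb R^n\to\mathbb R\times\mathbb R^m$ are $C^2$-smooth around a point $\bar x\in\Gamma$ with $g(\bar x)=0$. $\hat g(x):=(-g_0(x),g_r(x))$. $\nabla g(x)$ is the Jacobian, $\nabla g(x)^*$ its transpose, $\nabla^2 g(x)(u,v)\in\mathbb R^{1+m}$ is the vector with components $u^T\nabla^2 g_i(x)v$, and $\nabla^2\langle\lambda,g\rangle(x)=\sum_i\lambda_i\nabla^2 g_i(x)$. $\mathcal S$ is the unit sphere. Special multiplier: $\bar\lambda:=\dfrac{\|\nabla f(\bar x)\|}{\|\nabla g(\bar x)^*\nabla\hat g(\bar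 x)\bar u\|}\,\nabla\hat g(\bar x)\bar u$ (with $\bar\lambda:=0$ when $\nabla f(\bar x)=0$). MSCQ. The metric subregularity constraint qualification (MSCQ) holds at $\bar x$ with modulus $\sigma>0$ if there is a neighborhood $U$ of $\bar x$ with $\operatorname{dist}(x;\Gamma)\le\sigma\operatorname{dist}(g(x);\mathcal Q)$ for all $x\in U$. Cones. $T_\Gamma(x)$ is the Bouligand tangent cone $\{v:\exists t_k\downarrow0,\ v_k\to v,\ x+t_kv_k\in\Gamma\}$; the critical cone is $K_\Gamma(x,x^* ):=\{u\in T_\Gamma(x):\langle x^*,u\rangle=0\}$. Stationarity and tilt stability. $\bar x$ is a stationary point of (P) if $-\nabla f(\bar x)\in N_\Gamma(\bar x)$, where $N_\Gamma$ is the limiting (Mordukhovich) normal cone. Let $\varphi:=f+\delta_\Gamma$ ($\delta_\Gamma$ the indicator function of $\Gamma$). $\bar x$ is a tilt-stable local minimizer of (P) with modulus $\kappa>0$ if there is $\gamma>0$ such that $M_\gamma(v^* ):=\operatorname{argmin}\{\varphi(x)-\langle v^*,x\rangle:\|x-\bar x\|\le\gamma\}$ is single-valued and Lipschitz continuous with constant $\kappa$ on a neighborhood of $0$, with $M_\gamma(0)=\{\bar x\}$. The exact bound of tilt stability is $\mathrm{tilt}(\varphi,\bar x):=\inf_{\gamma>0}\operatorname{lip}M_\gamma(0)$, where $\operatorname{lip}M_\gamma(0)$ is the infimum of the Lipschitz constants of $M_\gamma$ on neighborhoods of $0$. *)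

(* Defs.v *)
From Stdlib Require Import Reals.
From mathcomp Require Import all_boot.
Set Implicit Arguments.
Unset Strict Implicit.
Open Scope R_scope.

Definition vec (n : nat) := 'I_n -> R.
Definition mat (n : nat) := 'I_n -> 'I_n -> R.

Definition dot {n} (x y : vec n) : R := \big[Rplus/0]_(i < n) (x i * y i).
Definition vnorm {n} (x : vec n) : R := sqrt (dot x x).
Definition vadd {n} (x y : vec n) : vec n := fun i => x i + y i.
Definition vsub {n} (x y : vec n) : vec n := fun i => x i - y i.
Definition vopp {n} (x : vec n) : vec n := fun i => - x i.
Definition vscale {n} (a : R) (x : vec n) : vec n := fun i => a * x i.
Definition vzero (n : nat) : vec n := fun _ => 0.
Definition quad {n} (A : mat n) (u : vec n) : R :=
  \big[Rplus/0]_(i < n) \big[Rplus/0]_(j < n) (u i * A i j * u j).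

Definition has_grad {n} (F : vec n -> R) (x G : vec n) : Prop :=
  forall eps, 0 < eps -> exists delta, 0 < delta /\
    forall h : vec n, vnorm h < delta ->
      Rabs (F (vadd x h) - F x - dot G h) <= eps * vnorm h.

Definition cont_at {n} (F : vec n -> R) (x : vec n) : Prop :=
  forall eps, 0 < eps -> exists delta, 0 < delta /\
    forall y, vnorm (vsub y x) < delta -> Rabs (F y - F x) < eps.

Definition C2_with {n} (F : vec n -> R) (DF : vec n -> vec n)
  (D2F : vec n -> mat n) (x0 : vec n) : Prop :=
  exists r, 0 < r /\ forall x, vnorm (vsub x x0) < r ->
    has_grad F x (DF x) /\
    (forall i, has_grad (fun y => DF y i) x (D2F x i)) /\
    (forall i j, cont_at (fun y => D2F y i j) x).

Definition in_Q {m} (q0 : R) (qr : vec m) : Prop := vnorm qr <= q0.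
Definition in_Gamma {n m} (g0 : vec n -> R) (gr : vec n -> vec m) (x : vec n) : Prop :=
  in_Q (g0 x) (gr x).

(* a is the infimum of E (E nonempty in all uses) *)
Definition is_inf (E : R -> Prop) (a : R) : Prop :=
  (forall t, E t -> a <= t) /\ (forall b, (forall t, E t -> b <= t) -> b <= a).

Definition MSCQ {n m} (g0 : vec n -> R) (gr : vec n -> vec m) (xbar : vec n)
  (sigma : R) : Prop :=
  0 < sigma /\ exists r, 0 < r /\ forall x, vnorm (vsub x xbar) < r ->
    forall d1 d2,
      is_inf (fun t => exists y, in_Gamma g0 gr y /\ t = vnorm (vsub x y)) d1 ->
      is_inf (fun t => exists q0 (qr : vec m), in_Q q0 qr /\
                 t = sqrt ((g0 x - q0) ^ 2 + (vnorm (vsub (gr x) qr)) ^ 2)) d2 ->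
      d1 <= sigma * d2.

Definition seq_cv {n} (s : nat -> vec n) (x : vec n) : Prop :=
  Un_cv (fun k => vnorm (vsub (s k) x)) 0.

Definition reg_normal {n} (C : vec n -> Prop) (x v : vec n) : Prop :=
  C x /\ forall eps, 0 < eps -> exists delta, 0 < delta /\
    forall y, C y -> vnorm (vsub y x) < delta ->
      dot v (vsub y x) <= eps * vnorm (vsub y x).

Definition lim_normal {n} (C : vec n -> Prop) (x v : vec n) : Prop :=
  C x /\ exists (xs vs : nat -> vec n),
    (forall k, reg_normal C (xs k) (vs k)) /\ seq_cv xs x /\ seq_cv vs v.

Definition tangent {n} (C : vec n -> Prop) (x v : vec n) : Prop :=
  exists (t : nat -> R) (vs : nat -> vec n),
    (forall k, 0 < t k) /\ Un_cv t 0 /\ seq_cv vs v /\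
    forall k, C (vadd x (vscale (t k) (vs k))).

Definition critical_cone {n} (C : vec n -> Prop) (x xs u : vec n) : Prop :=
  tangent C x u /\ dot xs u = 0.

Definition argminM {n} (f : vec n -> R) (C : vec n -> Prop) (xbar : vec n)
  (gamma : R) (v x : vec n) : Prop :=
  C x /\ vnorm (vsub x xbar) <= gamma /\
  forall y, C y -> vnorm (vsub y xbar) <= gamma -> f x - dot v x <= f y - dot v y.

Definition lip_single_on {n} (M : vec n -> vec n -> Prop) (delta L : R) : Prop :=
  (forall v, vnorm v < delta -> exists x, M v x /\ forall x', M v x' -> x' = x) /\
  (forall v1 v2 x1 x2, vnorm v1 < delta -> vnorm v2 < delta ->
     M v1 x1 -> M v2 x2 -> vnorm (vsub x1 x2) <= L * vnorm (vsub v1 v2)).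

Definition tilt_stable {n} (f : vec n -> R) (C : vec n -> Prop) (xbar : vec n)
  (kappa : R) : Prop :=
  0 < kappa /\ exists gamma, 0 < gamma /\
    (exists delta, 0 < delta /\ lip_single_on (argminM f C xbar gamma) delta kappa) /\
    (forall x, argminM f C xbar gamma (@vzero n) x <-> x = xbar).

(* tilt(f + delta_C, xbar) <= b, where tilt = inf_{gamma>0} lip M_gamma(0) and
   lip M_gamma(0) = inf of Lipschitz constants of M_gamma on neighborhoods of 0. *)
Definition tilt_le {n} (f : vec n -> R) (C : vec n -> Prop) (xbar : vec n)
  (b : R) : Prop :=
  forall eps, 0 < eps -> exists gamma L delta,
    0 < gamma /\ 0 <= L /\ L < b + eps /\ 0 < delta /\
    lip_single_on (argminM f C xbar gamma) delta L.

Definition jac_r {n m} (Dgr : 'I_m -> vec n) (u : vec n) : vec m :=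
  fun i => dot (Dgr i) u.
Definition gstar_ghat {n m} (Dg0 : vec n) (Dgr : 'I_m -> vec n) (u : vec n) : vec n :=
  fun j => - (dot Dg0 u) * Dg0 j + \big[Rplus/0]_(i < m) (dot (Dgr i) u * Dgr i j).
(* scalar factor ||grad f|| / ||nabla g^* nabla ghat u||; equals 0 when grad f = 0
   (since 0 / a = 0), matching the convention lambda := 0 in that case *)
Definition lam_coef {n m} (Df Dg0 : vec n) (Dgr : 'I_m -> vec n) (u : vec n) : R :=
  vnorm Df / vnorm (gstar_ghat Dg0 Dgr u).
Definition lam0 {n m} (Df Dg0 : vec n) (Dgr : 'I_m -> vec n) (u : vec n) : R :=
  lam_coef Df Dg0 Dgr u * (- dot Dg0 u).
Definition lamr {n m} (Df Dg0 : vec n) (Dgr : 'I_m -> vec n) (u : vec n) : vec m :=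
  fun i => lam_coef Df Dg0 Dgr u * dot (Dgr i) u.

(* Main.v *)
Require Import Defs.
From HB Require Import structures.
From Stdlib Require Import Reals Lra Psatz FunctionalExtensionality ClassicalEpsilon.
From mathcomp Require Import all_boot.
From Coquelicot Require Import Coquelicot.

(** Under MSCQ every regular normal v to Gamma at a point near xbar has a multiplier
    lambda in the normal cone of Q with [|lambda| <= 2 sigma |v|].  Complementarity with
    the critical direction ubar makes the special multiplier the only bounded
    multiplier at xbar, so that the multipliers of nearby stationary points of the
    tilted problems converge to it.  A compactness argument then upgrades the
    second-order condition to the uniform growth
    [f y >= f x + <v, y - x> + |y - x|^2 / (2 kappa)] for all feasible y and all
    stationary pairs (x, v) near (xbar, 0): if the growth fails along a sequence, then
    [- <lambda, g y>] is [O(|y - x|^2)], and this forces the limit of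
    [(y - x) / |y - x|] to satisfy the two equations of the second-order condition.
    Adding the growth inequality for two tilted minimizers gives the Lipschitz
    constant kappa; the bound on the exact modulus is the same result applied with
    [b + eps / 2] instead of kappa. *)

Set Implicit Arguments.
Unset Strict Implicit.
Unset Printing Implicit Defensive.
Open Scope R_scope.

(** The obstacle is a possibly degenerate Jacobian at xbar: the multipliers may form an unbounded
    set, and the image of the polar cone under the adjoint Jacobian need not be closed. The norm
    bound from MSCQ supplies the missing compactness, so it is carried along as one of the
    stationarity conditions. Since g(xbar) = 0, complementarity at xbar says nothing. The direction
    ubar replaces it: its image q under the Jacobian is a nonzero element of Q, and every multiplier
    at xbar is orthogonal to q because the gradient of f is orthogonal to ubar. An element of the
    polar cone orthogonal to q lies on the ray of the reflected vector (-q_0, q_r). The two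
    equations of the second-order condition have different sources. Write t = |y - x|. Orthogonality
    holds because the gap is O(t^2) while the increment of g is of order t. The second equation
    comes from [soc_complementarity]: there the gap is multiplied by g_0(y), which tends to 0
    because g_0(xbar) = 0, so the failure of parallelism is o(t). *)

Lemma Rplus_associative : associative Rplus.
Proof. by move=> x y z; rewrite Rplus_assoc. Qed.

HB.instance Definition _ :=
  Monoid.isComLaw.Build R 0 Rplus Rplus_associative Rplus_comm Rplus_0_l.

(** * Finite sums and Euclidean vectors *)

Ltac vext := apply: functional_extensionality => ?;
  rewrite /vadd /vsub /vscale /vopp /vzero; ring.

Lemma sumR_scal n (a : R) (F : 'I_n -> R) :
  \big[Rplus/0]_(i < n) (a * F i) = a * \big[Rplus/0]_(i < n) F i.
Proof.
by apply: (big_rec2 (fun u v => u = a * v)) => [|i u v _ ->]; ring.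
Qed.

Lemma sumR_le n (F F' : 'I_n -> R) : (forall i, F i <= F' i) ->
  \big[Rplus/0]_(i < n) F i <= \big[Rplus/0]_(i < n) F' i.
Proof.
move=> le_FF'; apply: (big_rec2 Rle) => [|i u v _ le_uv]; first lra.
by move: (le_FF' i) => ?; lra.
Qed.

Lemma sumR_const n (a : R) : \big[Rplus/0]_(i < n) a = INR n * a.
Proof.
elim: n => [|n IHn]; first by rewrite big_ord0 /=; ring.
by rewrite big_ord_recl IHn S_INR; ring.
Qed.

Lemma sumR_abs n (F : 'I_n -> R) :
  Rabs (\big[Rplus/0]_(i < n) F i) <= \big[Rplus/0]_(i < n) Rabs (F i).
Proof.
apply: (big_rec2 (fun u v => Rabs v <= u)) => [|i u v _ le_uv].
  by rewrite Rabs_R0; lra.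
by apply: Rle_trans (Rabs_triang _ _) _; lra.
Qed.

Lemma dotC n (x y : vec n) : dot x y = dot y x.
Proof. by apply: eq_bigr => i _; ring. Qed.

Lemma dotDl n (x y z : vec n) : dot (vadd x y) z = dot x z + dot y z.
Proof. by rewrite /dot -big_split; apply: eq_bigr => i _; rewrite /vadd /=; ring. Qed.

Lemma dotZl n a (x y : vec n) : dot (vscale a x) y = a * dot x y.
Proof. by rewrite /dot -sumR_scal; apply: eq_bigr => i _; rewrite /vscale; ring. Qed.

Lemma dotNl n (x y : vec n) : dot (vopp x) y = - dot x y.
Proof.
have -> : vopp x = vscale (-1) x by vext.
by rewrite dotZl; ring.
Qed.

Lemma dotBl n (x y z : vec n) : dot (vsub x y) z = dot x z - dot y z.
Proof.
have -> : vsub x y = vadd x (vopp y) by vext.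
by rewrite dotDl dotNl; ring.
Qed.

Lemma dot0l n (x : vec n) : dot (@vzero n) x = 0.
Proof.
have -> : @vzero n = vscale 0 x by vext.
by rewrite dotZl; ring.
Qed.

Lemma dotDr n (x y z : vec n) : dot z (vadd x y) = dot z x + dot z y.
Proof. by rewrite dotC dotDl !(dotC _ z). Qed.

Lemma dotZr n a (x y : vec n) : dot y (vscale a x) = a * dot y x.
Proof. by rewrite dotC dotZl dotC. Qed.

Lemma dotNr n (x y : vec n) : dot y (vopp x) = - dot y x.
Proof. by rewrite dotC dotNl dotC. Qed.

Lemma dotBr n (x y z : vec n) : dot z (vsub x y) = dot z x - dot z y.
Proof. by rewrite dotC dotBl !(dotC _ z). Qed.

Lemma dot0r n (x : vec n) : dot x (@vzero n) = 0.
Proof. by rewrite dotC dot0l. Qed.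

Definition dotE := (dotDl, dotDr, dotBl, dotBr, dotZl, dotZr, dotNl, dotNr,
  dot0l, dot0r).

Lemma dot_ge0 n (x : vec n) : 0 <= dot x x.
Proof.
apply: (big_ind (fun u => 0 <= u)) => [|u v ? ?|i _]; [lra|lra|nra].
Qed.

Lemma vnorm_ge0 n (x : vec n) : 0 <= vnorm x.
Proof. exact: sqrt_pos. Qed.

Lemma vnorm_mul n (x : vec n) : vnorm x * vnorm x = dot x x.
Proof. exact/sqrt_sqrt/dot_ge0. Qed.

Lemma vnorm_sqr n (x : vec n) : vnorm x ^ 2 = dot x x.
Proof. by rewrite -vnorm_mul; ring. Qed.

Lemma vnorm_le n (x : vec n) a : 0 <= a -> dot x x <= a * a -> vnorm x <= a.
Proof. by move=> a_ge0; rewrite -vnorm_mul; move: (vnorm_ge0 x) => *; nra. Qed.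

Lemma coord_le_vnorm n (x : vec n) i : Rabs (x i) <= vnorm x.
Proof.
rewrite -(sqrt_Rsqr_abs (x i)); apply: sqrt_le_1_alt.
rewrite /dot (bigD1 i) //= /Rsqr.
rewrite -[X in X <= _]Rplus_0_r; apply: Rplus_le_compat_l.
by apply: (big_ind (fun u => 0 <= u)) => [|u v ? ?|j _]; [lra|lra|nra].
Qed.

Lemma vnorm0 n : vnorm (@vzero n) = 0.
Proof. by rewrite /vnorm dot0l sqrt_0. Qed.

Lemma vnorm_eq0 n (x : vec n) : vnorm x = 0 -> x = @vzero n.
Proof.
move=> x0; apply: functional_extensionality => i.
move: (coord_le_vnorm x i); rewrite x0 /vzero.
by move=> x_le0; apply: Rabs_eq_0; move: (Rabs_pos (x i)) => *; lra.
Qed.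

Lemma vnorm_gt0 n (x : vec n) : x <> @vzero n -> 0 < vnorm x.
Proof.
move=> x_neq0; case: (vnorm_ge0 x) => // x0.
by case: x_neq0; apply: vnorm_eq0.
Qed.

Lemma vnormZ n a (x : vec n) : vnorm (vscale a x) = Rabs a * vnorm x.
Proof.
rewrite /vnorm !dotE -Rmult_assoc sqrt_mult; [|nra|exact: dot_ge0].
by rewrite sqrt_Rsqr_abs.
Qed.

Lemma dot_le_vnorm n (x y : vec n) : dot x y <= vnorm x * vnorm y.
Proof.
have [x0|x_neq0] := Req_dec (vnorm x) 0.
  by rewrite x0 (vnorm_eq0 x0) dot0l; lra.
have x_gt0 : 0 < vnorm x by move: (vnorm_ge0 x) => *; lra.
have [y0|y_neq0] := Req_dec (vnorm y) 0.
  by rewrite y0 (vnorm_eq0 y0) dot0r; lra.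
have y_gt0 : 0 < vnorm y by move: (vnorm_ge0 y) => *; lra.
have := dot_ge0 (vsub (vscale (vnorm y) x) (vscale (vnorm x) y)).
rewrite !dotE (dotC y x) -!vnorm_mul => h.
have : 0 <= 2 * (vnorm x * vnorm y) * (vnorm x * vnorm y - dot x y) by nra.
have ab_gt0 := Rmult_lt_0_compat _ _ x_gt0 y_gt0.
by move=> ?; apply: Rnot_lt_le => ?; nra.
Qed.

Lemma dot_abs_le n (x y : vec n) : Rabs (dot x y) <= vnorm x * vnorm y.
Proof.
apply: Rabs_le; split; last exact: dot_le_vnorm.
have := dot_le_vnorm (vscale (-1) x) y.
by rewrite dotZl vnormZ Rabs_Ropp Rabs_R1; lra.
Qed.

Lemma vnormD n (x y : vec n) : vnorm (vadd x y) <= vnorm x + vnorm y.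
Proof.
apply: vnorm_le; first by move: (vnorm_ge0 x) (vnorm_ge0 y) => *; lra.
by rewrite !dotE (dotC y x) -!vnorm_mul; move: (dot_le_vnorm x y) => *; lra.
Qed.

Lemma vnormBC n (x y : vec n) : vnorm (vsub x y) = vnorm (vsub y x).
Proof. by rewrite /vnorm !dotE; congr sqrt; ring. Qed.

Lemma vdist_triangle n (x y z : vec n) :
  vnorm (vsub x z) <= vnorm (vsub x y) + vnorm (vsub y z).
Proof.
have -> : vsub x z = vadd (vsub x y) (vsub y z) by vext.
exact: vnormD.
Qed.

Lemma vaddBK n (x y : vec n) : vadd x (vsub y x) = y.
Proof. by vext. Qed.

Lemma vsubDK n (x h : vec n) : vsub (vadd x h) x = h.
Proof. by vext. Qed.

Lemma vsub_eq0 n (x y : vec n) : vsub x y = @vzero n -> x = y.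
Proof. by move=> e; rewrite -[x](vaddBK y) e; vext. Qed.

Lemma vnorm_le_coord n (x : vec n) e : 0 <= e ->
  (forall i, Rabs (x i) <= e) -> vnorm x <= INR n * e.
Proof.
move=> e_ge0 le_xe.
have n_ge0 := pos_INR n.
have ne_ge0 : 0 <= INR n * e by nra.
apply: vnorm_le => //; have [x0|x_neq0] := Req_dec (vnorm x) 0.
  by rewrite -vnorm_mul x0; nra.
suff : vnorm x * vnorm x <= vnorm x * (INR n * e).
  by move: (vnorm_ge0 x) => ?; rewrite -vnorm_mul => ?; nra.
rewrite vnorm_mul (_ : _ * _ = INR n * (vnorm x * e)); last ring.
rewrite -sumR_const; apply: sumR_le => i.
apply: Rle_trans (Rle_abs _) _; rewrite Rabs_mult.
apply: Rmult_le_compat (le_xe i); try exact: Rabs_pos.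
exact: coord_le_vnorm.
Qed.

Definition adj {n p} (A : 'I_p -> vec n) (l : vec p) : vec n :=
  fun j => \big[Rplus/0]_(i < p) (l i * A i j).

Lemma dot_adj n p (A : 'I_p -> vec n) l h : dot (adj A l) h = dot l (jac_r A h).
Proof.
rewrite /dot /adj /jac_r /dot.
under eq_bigr => j _ do rewrite Rmult_comm -sumR_scal.
rewrite exchange_big; apply: eq_bigr => i _ /=.
by rewrite -sumR_scal; apply: eq_bigr => j _; ring.
Qed.

Lemma dot_inj n (x y : vec n) : (forall h, dot x h = dot y h) -> x = y.
Proof.
move=> e; apply/vsub_eq0/vnorm_eq0.
by rewrite /vnorm dotBl e Rminus_diag sqrt_0.
Qed.

(** * Sequences, compactness and existence of minimizers *)

Lemma choice_fun A B (P : A -> B -> Prop) : (forall a, exists b, P a b) ->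
  exists f, forall a, P a (f a).
Proof.
move=> H; exists (fun a => proj1_sig (constructive_indefinite_description _ (H a))).
by move=> a; case: constructive_indefinite_description.
Qed.

(** Coordinatewise convergence lets real limit theorems apply entry by entry; [vlim_dist] and
    [vlim_of_dist] connect it with convergence in norm. *)
Definition vlim {n} (s : nat -> vec n) (x : vec n) : Prop :=
  forall i, is_lim_seq (fun k => s k i) (x i).

(** Monotonicity is not asked: [k <= phi k] already transports limits, is stable under composition,
    and is what a cluster value gives directly. *)
Definition extraction (phi : nat -> nat) : Prop := forall k, (k <= phi k)%coq_nat.

Lemma lim_extraction u l phi : extraction phi -> is_lim_seq u l ->
  is_lim_seq (fun k => u (phi k)) l.
Proof.
move=> ephi; apply: is_lim_seq_subseq => P [N HN].
by exists N => k le_Nk; apply: HN; apply: Nat.le_trans le_Nk (ephi k).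
Qed.

Lemma vlim_extraction n (s : nat -> vec n) x phi : extraction phi -> vlim s x ->
  vlim (fun k => s (phi k)) x.
Proof. by move=> ephi sx i; apply: (lim_extraction ephi (sx i)). Qed.

Lemma lim_sumR n (u : nat -> 'I_n -> R) (l : 'I_n -> R) :
  (forall i, is_lim_seq (fun k => u k i) (l i)) ->
  is_lim_seq (fun k => \big[Rplus/0]_(i < n) u k i) (\big[Rplus/0]_(i < n) l i).
Proof.
elim: n u l => [|n IHn] u l ul.
  rewrite big_ord0; apply: is_lim_seq_ext (is_lim_seq_const 0) => k.
  by rewrite big_ord0.
rewrite big_ord_recl.
apply: (is_lim_seq_ext
    (fun k => u k ord0 + \big[Rplus/0]_(i < n) u k (lift ord0 i))) => [k|].
  by rewrite big_ord_recl.
by apply: is_lim_seq_plus' => //; apply: IHn => i.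
Qed.

Lemma lim_dot n (s t : nat -> vec n) x y : vlim s x -> vlim t y ->
  is_lim_seq (fun k => dot (s k) (t k)) (dot x y).
Proof. by move=> sx ty; apply: lim_sumR => i; apply: is_lim_seq_mult'. Qed.

Lemma lim_quad n (A : mat n) (s : nat -> vec n) x : vlim s x ->
  is_lim_seq (fun k => quad A (s k)) (quad A x).
Proof.
move=> sx; do 2! [apply: lim_sumR => ?].
apply: is_lim_seq_mult' => //; apply: is_lim_seq_mult' => //.
exact: is_lim_seq_const.
Qed.

Lemma lim_vnorm n (s : nat -> vec n) x : vlim s x ->
  is_lim_seq (fun k => vnorm (s k)) (vnorm x).
Proof.
move=> sx; apply: (is_lim_seq_continuous sqrt); last exact: lim_dot.
exact/continuity_pt_sqrt/dot_ge0.
Qed.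

Lemma vlim_const n (x : vec n) : vlim (fun _ => x) x.
Proof. by move=> i; apply: is_lim_seq_const. Qed.
Arguments vlim_const {n} x.

Lemma vlimD n (s t : nat -> vec n) x y : vlim s x -> vlim t y ->
  vlim (fun k => vadd (s k) (t k)) (vadd x y).
Proof. by move=> sx ty i; apply: (is_lim_seq_plus' _ _ _ _ (sx i) (ty i)). Qed.

Lemma vlimB n (s t : nat -> vec n) x y : vlim s x -> vlim t y ->
  vlim (fun k => vsub (s k) (t k)) (vsub x y).
Proof. by move=> sx ty i; apply: (is_lim_seq_minus' _ _ _ _ (sx i) (ty i)). Qed.

Lemma vlimZ n (u : nat -> R) (a : R) (s : nat -> vec n) x : is_lim_seq u a -> vlim s x ->
  vlim (fun k => vscale (u k) (s k)) (vscale a x).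
Proof. by move=> ua sx i; apply: (is_lim_seq_mult' _ _ _ _ ua (sx i)). Qed.

Lemma vlim_adj n p (A : nat -> 'I_p -> vec n) A0 (l : nat -> vec p) l0 :
  (forall i, vlim (fun k => A k i) (A0 i)) -> vlim l l0 ->
  vlim (fun k => adj (A k) (l k)) (adj A0 l0).
Proof.
move=> AA0 ll0 j; apply: lim_sumR => i.
by apply: is_lim_seq_mult' => //; apply: AA0.
Qed.

Lemma vlim_dist n (s : nat -> vec n) x : vlim s x ->
  is_lim_seq (fun k => vnorm (vsub (s k) x)) 0.
Proof.
move=> sx; rewrite -(vnorm0 n); have -> : @vzero n = vsub x x by vext.
exact/lim_vnorm/vlimB/vlim_const.
Qed.

Lemma lim_seq_sandwich0 u v (l : R) : is_lim_seq v 0 ->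
  (forall k, Rabs (u k - l) <= v k) -> is_lim_seq u l.
Proof.
move=> v0 uv.
apply: (is_lim_seq_le_le (fun k => l - v k) _ (fun k => l + v k)).
- by move=> k; move: (uv k) => /Rabs_le_between; lra.
- rewrite -[X in is_lim_seq _ (Finite X)]Rminus_0_r.
  by apply: is_lim_seq_minus' => //; apply: is_lim_seq_const.
- rewrite -[X in is_lim_seq _ (Finite X)]Rplus_0_r.
  by apply: is_lim_seq_plus' => //; apply: is_lim_seq_const.
Qed.

Lemma vlim_of_dist n (s : nat -> vec n) x :
  is_lim_seq (fun k => vnorm (vsub (s k) x)) 0 -> vlim s x.
Proof.
move=> sx i; apply: lim_seq_sandwich0 sx _ => k.
exact: (coord_le_vnorm (vsub (s k) x) i).
Qed.

Lemma vlim_seq_cv n (s : nat -> vec n) x : seq_cv s x -> vlim s x.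
Proof. by move=> sx; apply/vlim_of_dist/is_lim_seq_Reals. Qed.

Lemma lim_eps u (l : R) : (forall eps, 0 < eps ->
    exists N, forall k, (N <= k)%coq_nat -> Rabs (u k - l) <= eps) ->
  is_lim_seq u l.
Proof.
move=> H; apply/is_lim_seq_spec => eps /=.
have [|N HN] := H (eps / 2); first by move: (cond_pos eps); lra.
by exists N => k /HN; move: (cond_pos eps); lra.
Qed.

Lemma lim_eventually u l : is_lim_seq u (Finite l) -> forall eps, 0 < eps ->
  exists N, forall k, (N <= k)%coq_nat -> Rabs (u k - l) < eps.
Proof. by move=> /is_lim_seq_spec ul eps eps_gt0; apply: (ul (mkposreal _ eps_gt0)). Qed.

Definition inv_succ (k : nat) : R := / (INR k + 1).

Lemma inv_succ_gt0 k : 0 < inv_succ k.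
Proof. by apply: Rinv_0_lt_compat; move: (pos_INR k); lra. Qed.

Lemma lim_inv_succ : is_lim_seq inv_succ 0.
Proof.
apply: (is_lim_seq_ext (fun k => / INR k.+1)) => [k|].
  by rewrite S_INR.
apply/(is_lim_seq_incr_1 (fun k => / INR k)).
have -> : Finite 0 = Rbar_inv p_infty by [].
by apply: is_lim_seq_inv => //; apply: is_lim_seq_INR.
Qed.

Lemma lim_le_inv_succ u (l : R) : (forall k, Rabs (u k - l) <= inv_succ k) ->
  is_lim_seq u l.
Proof. exact: lim_seq_sandwich0 lim_inv_succ. Qed.

Lemma Bolzano_Weierstrass_R u M : (forall k, Rabs (u k) <= M) ->
  exists phi l, extraction phi /\ is_lim_seq (fun k => u (phi k)) (Finite l).
Proof.
move=> uM.
have [|l Hl] := Bolzano_Weierstrass u _ (compact_P3 (- M) M).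
  by move=> k; apply/Rabs_le_between/uM.
have H k : exists p, (k <= p)%coq_nat /\ Rabs (u p - l) <= inv_succ k.
  have [|p [le_kp up]] := Hl (disc l (mkposreal _ (inv_succ_gt0 k))) k.
    exists (mkposreal _ (inv_succ_gt0 k)); exact: (fun x h => h).
  by exists p; split => //; apply: Rlt_le.
have [phi Hphi] := choice_fun H.
exists phi, l; split=> [k|]; first by case: (Hphi k).
by apply: lim_le_inv_succ => k; case: (Hphi k).
Qed.

(** Coordinates are treated one at a time along a list; each new extraction preserves the limits
    already obtained. *)
Lemma Bolzano_Weierstrass_vec n (s : nat -> vec n) M :
  (forall k, vnorm (s k) <= M) ->
  exists phi x, extraction phi /\ vlim (fun k => s (phi k)) x.
Proof.
move=> sM.
suff H (r : seq 'I_n) : exists phi x, extraction phi /\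
    forall i, i \in r -> is_lim_seq (fun k => s (phi k) i) (Finite (x i)).
  have [phi [x [ephi lim]]] := H (enum 'I_n).
  by exists phi, x; split=> // i; apply: lim; rewrite mem_enum.
elim: r => [|i r [phi [x [ephi lim]]]].
  by exists id, (@vzero n); split=> // k.
have [k|psi [l [epsi liml]]] := @Bolzano_Weierstrass_R (fun k => s (phi k) i) M.
  exact: Rle_trans (coord_le_vnorm _ _) (sM _).
exists (fun k => phi (psi k)), (fun j => if j == i then l else x j).
split=> [k|j]; first exact: Nat.le_trans (epsi k) (ephi _).
rewrite inE; case: eqP => [-> //|_ /= jr].
exact: (lim_extraction epsi (lim _ jr)).
Qed.

Lemma vlim_unique n (s : nat -> vec n) x y : vlim s x -> vlim s y -> x = y.
Proof.
move=> sx sy; apply: functional_extensionality => i.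
have := is_lim_seq_unique _ _ (sx i).
by rewrite (is_lim_seq_unique _ _ (sy i)) => -[].
Qed.

Definition vclosed {n} (C : vec n -> Prop) : Prop :=
  forall s x, vlim s x -> (forall k, C (s k)) -> C x.

(** Weierstrass theorem. Continuity is asked only along sequences inside [C], because f is
    controlled only near xbar. Boundedness below comes first: otherwise values below [- INR k] would
    contradict the finite limit along a convergent subsequence. *)
Lemma vec_minimum_exists n (C : vec n -> Prop) (F : vec n -> R) M x0 :
  vclosed C -> (forall x, C x -> vnorm x <= M) -> C x0 ->
  (forall s x, vlim s x -> (forall k, C (s k)) -> C x ->
     is_lim_seq (fun k => F (s k)) (F x)) ->
  exists x, C x /\ forall y, C y -> F x <= F y.
Proof.
move=> clC CM Cx0 contF.
have bounded_below : exists b, forall x, C x -> b <= F x.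
  apply: NNPP => nb.
  have H k : exists x, C x /\ F x < - INR k.
    apply: NNPP => nk; apply: nb; exists (- INR k) => x Cx.
    by apply: Rnot_lt_le => ?; apply: nk; exists x.
  have [s Hs] := choice_fun H.
  have [k|phi [x [ephi sx]]] := @Bolzano_Weierstrass_vec _ s M.
    by apply: CM; case: (Hs k).
  have Cs k : C (s (phi k)) by case: (Hs (phi k)).
  have limF := contF _ _ sx Cs (clC _ _ sx Cs).
  have : is_lim_seq (fun k => F (s (phi k))) m_infty.
    apply: (is_lim_seq_le_m_loc (fun k => - INR k)); last first.
      by apply/(is_lim_seq_opp INR p_infty)/is_lim_seq_INR.
    exists O => k _; case: (Hs (phi k)) => _ lt_F.
    by move: (le_INR _ _ (ephi k)); lra.
  by move/is_lim_seq_unique; rewrite (is_lim_seq_unique _ _ limF).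
have [b Hb] := bounded_below.
have [||inf [inf_ub inf_lub]] :=
    completeness (fun t => exists x, C x /\ t = - F x).
- by exists (- b) => t [x [Cx ->]]; move: (Hb x Cx); lra.
- by exists (- F x0), x0.
have H k : exists x, C x /\ F x < - inf + inv_succ k.
  apply: NNPP => nk.
  suff : inf <= inf - inv_succ k by move: (inv_succ_gt0 k); lra.
  apply: inf_lub => t [x [Cx ->]]; apply: Rnot_lt_le => ?.
  by apply: nk; exists x; split=> //; lra.
have [s Hs] := choice_fun H.
have [k|phi [x [ephi sx]]] := @Bolzano_Weierstrass_vec _ s M.
  by apply: CM; case: (Hs k).
have Cs k : C (s (phi k)) by case: (Hs (phi k)).
have Cx := clC _ _ sx Cs; exists x; split=> // y Cy.
apply: (@Rle_trans _ (- inf)); last first.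
  by have := inf_ub (- F y) (ex_intro _ y (conj Cy erefl)); lra.
have : Rbar_le (Finite (F x)) (Finite (- inf)); last by [].
apply: (is_lim_seq_le (fun k => F (s (phi k))) (fun k => - inf + inv_succ (phi k))).
- by move=> k; apply: Rlt_le; case: (Hs (phi k)).
- exact: contF.
rewrite -[X in is_lim_seq _ (Finite X)]Rplus_0_r.
apply: is_lim_seq_plus'; first exact: is_lim_seq_const.
exact: (lim_extraction ephi lim_inv_succ).
Qed.

(** * Differentiability and second-order expansions *)

Lemma ord_common_radius n (P : 'I_n -> R -> Prop) :
  (forall i, exists d, 0 < d /\ P i d) ->
  (forall i d d', P i d -> d' <= d -> P i d') ->
  exists d, 0 < d /\ forall i, P i d.
Proof.
move=> exP monoP.
suff [d [d_gt0 Hd]] : exists d, 0 < d /\ forall i, i \in enum 'I_n -> P i d.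
  by exists d; split=> // i; apply: Hd; rewrite mem_enum.
elim: (enum 'I_n) => [|i r [d [d_gt0 Hd]]]; first by exists 1; split=> //; lra.
have [d' [d'_gt0 Hd']] := exP i; exists (Rmin d d').
split=> [|j]; first exact: Rmin_pos.
rewrite inE => /orP[/eqP->|jr]; first exact: (monoP _ _ _ Hd' (Rmin_r _ _)).
exact: (monoP _ _ _ (Hd _ jr) (Rmin_l _ _)).
Qed.

Lemma has_grad_lim n (F : vec n -> R) x G s : has_grad F x G -> vlim s x ->
  is_lim_seq (fun k => F (s k)) (F x).
Proof.
move=> gF sx; have [d [d_gt0 Hd]] := gF 1 Rlt_0_1.
have [N HN] := lim_eventually (vlim_dist sx) d_gt0.
apply/(is_lim_seq_incr_n _ N).
apply: (@lim_seq_sandwich0 _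
  (fun k => (1 + vnorm G) * vnorm (vsub (s (k + N)%coq_nat) x))).
  rewrite -[X in is_lim_seq _ (Finite X)](Rmult_0_r (1 + vnorm G)).
  apply: is_lim_seq_mult'; first exact: is_lim_seq_const.
  exact: (is_lim_seq_incr_n (fun k => vnorm (vsub (s k) x)) N 0).1 (vlim_dist sx).
move=> k; have /HN : (N <= k + N)%coq_nat by apply: Nat.le_add_l.
set y := s _; rewrite Rminus_0_r Rabs_pos_eq; last exact: vnorm_ge0.
move=> /Hd; rewrite vaddBK => /Rabs_le_between ?.
move: (dot_abs_le G (vsub y x)) => /Rabs_le_between ?.
by apply: Rabs_le; lra.
Qed.

Lemma has_grad_vlim n p (F : vec n -> vec p) x G s :
  (forall i, has_grad (fun y => F y i) x (G i)) -> vlim s x ->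
  vlim (fun k => F (s k)) (F x).
Proof. by move=> gF sx i; apply: has_grad_lim (gF i) sx. Qed.

Lemma has_grad_line n (F : vec n -> R) x d c G :
  has_grad F (vadd x (vscale c d)) G ->
  derivable_pt_lim (fun t => F (vadd x (vscale t d))) c (dot G d).
Proof.
(* The [+ 1] keeps the denominator positive when d = 0. *)
move=> gF eps eps_gt0; have d_ge0 := vnorm_ge0 d.
have [|r [r_gt0 Hr]] := gF (eps / (2 * (vnorm d + 1))).
  by apply: Rdiv_lt_0_compat; lra.
have rd_gt0 : 0 < r / (vnorm d + 1) by apply: Rdiv_lt_0_compat; lra.
exists (mkposreal _ rd_gt0) => h h_neq0 /= h_lt.
have {Hr} := Hr (vscale h d); rewrite vnormZ dotE.
have -> : vadd (vadd x (vscale c d)) (vscale h d) = vadd x (vscale (c + h) d) by vext.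
have h_gt0 := Rabs_pos_lt _ h_neq0.
have Hlt : Rabs h * (vnorm d + 1) < r.
  by move/(Rmult_lt_compat_r (vnorm d + 1)): h_lt; rewrite /Rdiv Rmult_assoc Rinv_l; lra.
move=> /(_ ltac:(nra)); set u := F _ - F _ => le_u.
have -> : u / h - dot G d = (u - h * dot G d) / h by field.
rewrite Rabs_div //; apply: (Rmult_lt_reg_r (Rabs h)) => //.
rewrite /Rdiv Rmult_assoc Rinv_l ?Rmult_1_r; last lra.
apply: Rle_lt_trans le_u _.
have -> : eps / (2 * (vnorm d + 1)) * (Rabs h * vnorm d) =
  eps * Rabs h * (vnorm d / (2 * (vnorm d + 1))) by field; lra.
have lt1 : vnorm d / (2 * (vnorm d + 1)) < 1.
  by apply: (Rmult_lt_reg_r (2 * (vnorm d + 1))); [lra|rewrite /Rdiv Rmult_assoc Rinv_l; lra].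
have := Rmult_lt_0_compat _ _ eps_gt0 h_gt0.
by nra.
Qed.

Lemma quad_diff_le n (A B : mat n) e d : 0 <= e ->
  (forall i j, Rabs (A i j - B i j) <= e) ->
  Rabs (quad A d - quad B d) <= INR n * INR n * e * vnorm d ^ 2.
Proof.
move=> e_ge0 AB.
have -> : quad A d - quad B d = \big[Rplus/0]_(i < n) \big[Rplus/0]_(j < n)
    (d i * (A i j - B i j) * d j).
  rewrite (_ : _ - _ = quad A d + -1 * quad B d); last ring.
  rewrite /quad -sumR_scal -big_split; apply: eq_bigr => i _ /=.
  rewrite -sumR_scal -big_split; apply: eq_bigr => j _ /=; ring.
apply: Rle_trans (sumR_abs _) _.
rewrite (_ : _ * _ = INR n * (INR n * (e * vnorm d ^ 2))); last ring.
rewrite -sumR_const; apply: sumR_le => i.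
apply: Rle_trans (sumR_abs _) _.
rewrite -sumR_const; apply: sumR_le => j.
rewrite !Rabs_mult (_ : e * vnorm d ^ 2 = vnorm d * e * vnorm d); last ring.
have := coord_le_vnorm d i; have := coord_le_vnorm d j; have := AB i j.
have := Rabs_pos (d i); have := Rabs_pos (d j); have := Rabs_pos (A i j - B i j).
move=> ? ? ? ? ? ?; apply: Rmult_le_compat => //; first by nra.
exact: Rmult_le_compat.
Qed.

Lemma dot_quad n (A : mat n) d : dot (fun i => dot (A i) d) d = quad A d.
Proof.
apply: eq_bigr => i _; rewrite Rmult_comm /dot -sumR_scal.
by apply: eq_bigr => j _; ring.
Qed.

Lemma quadZ n (A : mat n) a d : quad A (vscale a d) = a ^ 2 * quad A d.
Proof.
rewrite /quad -sumR_scal; apply: eq_bigr => i _.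
by rewrite -sumR_scal; apply: eq_bigr => j _; rewrite /vscale; ring.
Qed.

Lemma vdist_segment n (x y x0 : vec n) t r : 0 <= t <= 1 ->
  vnorm (vsub x x0) < r -> vnorm (vsub y x0) < r ->
  vnorm (vsub (vadd x (vscale t (vsub y x))) x0) < r.
Proof.
move=> t01 xr yr.
have -> : vsub (vadd x (vscale t (vsub y x))) x0 =
  vadd (vscale (1 - t) (vsub x x0)) (vscale t (vsub y x0)) by vext.
apply: Rle_lt_trans (vnormD _ _) _; rewrite !vnormZ !Rabs_pos_eq; try lra.
by case: (Req_dec t 0) => ?; nra.
Qed.

Lemma derivable_sumR n (u : 'I_n -> R -> R) c (l : 'I_n -> R) :
  (forall i, derivable_pt_lim (u i) c (l i)) ->
  derivable_pt_lim (fun t => \big[Rplus/0]_(i < n) u i t) c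
    (\big[Rplus/0]_(i < n) l i).
Proof.
elim: n u l => [|n IHn] u l ul.
  rewrite big_ord0 (_ : (fun _ => _) = fct_cte 0); first exact: derivable_pt_lim_const.
  by apply: functional_extensionality => t; rewrite big_ord0.
rewrite big_ord_recl.
rewrite (_ : (fun t => _) =
  (u ord0 + (fun t => \big[Rplus/0]_(i < n) u (lift ord0 i) t))%F).
  by apply: derivable_pt_lim_plus => //; apply: IHn.
by apply: functional_extensionality => t; rewrite big_ord_recl.
Qed.

(** The expansion is uniform in the base point: the Hessian is frozen at x0 while x and y both move.
    The mean value theorem is used twice, once on the directional derivative ([mvt1]) and once on F
    minus its quadratic model along the segment. *)
Lemma taylor2 n (F : vec n -> R) DF D2F x0 : C2_with F DF D2F x0 ->
  forall eps, 0 < eps -> exists r, 0 < r /\ forall x y,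
    vnorm (vsub x x0) < r -> vnorm (vsub y x0) < r ->
    Rabs (F y - F x - dot (DF x) (vsub y x) - / 2 * quad (D2F x0) (vsub y x))
      <= eps * vnorm (vsub y x) ^ 2.
Proof.
move=> [r1 [r1_gt0 HF]] eps eps_gt0.
have nn := pos_INR n.
(* [quad_diff_le] costs a factor n^2 when passing from entries to the quadratic form. *)
set e := eps / (INR n * INR n + 1).
have e_gt0 : 0 < e by apply: Rdiv_lt_0_compat; nra.
have [||r2 [r2_gt0 Hr2]] := @ord_common_radius n (fun i r => forall j y,
    vnorm (vsub y x0) < r -> Rabs (D2F y i j - D2F x0 i j) <= e).
- move=> i; apply: ord_common_radius => [j|j r r' Hr ler y ?].
    have [|_ [_ cD2F]] := HF x0.
      by rewrite (_ : vsub _ _ = @vzero n); [rewrite vnorm0|vext].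
    have [r [r_gt0 Hr]] := cD2F i j e e_gt0.
    by exists r; split=> // y /Hr /Rlt_le.
  by apply: Hr; lra.
- by move=> i r r' Hr ler j y ?; apply: Hr; lra.
exists (Rmin r1 r2); split; first exact: Rmin_pos.
move=> x y x_r y_r; set d := vsub y x.
have seg t : 0 <= t <= 1 -> vnorm (vsub (vadd x (vscale t d)) x0) < Rmin r1 r2.
  by move=> t01; apply: vdist_segment.
have dF t : 0 <= t <= 1 -> derivable_pt_lim (fun t => F (vadd x (vscale t d))) t
    (dot (DF (vadd x (vscale t d))) d).
  move=> /seg t_r; apply: has_grad_line.
  by have [|? _] := HF (vadd x (vscale t d)) _ => //; move: (Rmin_l r1 r2); lra.
have dDF t : 0 <= t <= 1 ->
    derivable_pt_lim (fun t => dot (DF (vadd x (vscale t d))) d) t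
      (quad (D2F (vadd x (vscale t d))) d).
  move=> /seg t_r; rewrite -dot_quad.
  have [|_ [gDF _]] := HF (vadd x (vscale t d)); first by move: (Rmin_l r1 r2); lra.
  have H i := has_grad_line (gDF i).
  rewrite [X in derivable_pt_lim _ _ X]/dot; apply: derivable_sumR => i.
  rewrite (_ : (fun t0 => _) =
    mult_real_fct (d i) (fun t => DF (vadd x (vscale t d)) i)).
    by rewrite Rmult_comm; apply: derivable_pt_lim_scal.
  by apply: functional_extensionality => t'; rewrite /mult_real_fct; ring.
pose q := quad (D2F x0) d.
have qe t : 0 <= t <= 1 ->
    Rabs (quad (D2F (vadd x (vscale t d))) d - q) <= eps * vnorm d ^ 2.
  move=> /seg t_r; apply: Rle_trans (@quad_diff_le _ _ _ e _ _ _) _.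
  - by lra.
  - by move=> i j; apply: Hr2; move: (Rmin_r r1 r2); lra.
  apply: Rmult_le_compat_r; first by nra.
  have -> : eps = (INR n * INR n + 1) * e by rewrite /e; field; nra.
  by nra.
have mvt1 t : 0 < t <= 1 ->
    Rabs (dot (DF (vadd x (vscale t d))) d - dot (DF x) d - t * q)
      <= eps * vnorm d ^ 2.
  move=> t01.
  have [|c [eqc c_t]] := MVT_cor2
    (fun t => dot (DF (vadd x (vscale t d))) d)
    (fun t => quad (D2F (vadd x (vscale t d))) d) 0 t t01.1.
    by move=> c c_t; apply: dDF; lra.
  have e0 : vadd x (vscale 0 d) = x by vext.
  rewrite e0 in eqc; rewrite eqc (_ : _ - _ =
    t * (quad (D2F (vadd x (vscale c d))) d - q)); last ring.
  rewrite Rabs_mult Rabs_pos_eq; last lra.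
  have := qe c ltac:(lra); have := Rabs_pos (quad (D2F (vadd x (vscale c d))) d - q).
  by nra.
have [|c [eqc c_01]] := MVT_cor2
  (fun t => F (vadd x (vscale t d)) - t * dot (DF x) d - t ^ 2 / 2 * q)
  (fun t => dot (DF (vadd x (vscale t d))) d - dot (DF x) d - t * q) 0 1 Rlt_0_1.
  move=> c c_01; apply: derivable_pt_lim_minus.
    apply: derivable_pt_lim_minus; first exact: dF.
    apply/is_derive_Reals; auto_derive => //; ring.
  by apply/is_derive_Reals; auto_derive => //; field.
have := mvt1 c ltac:(lra).
have e0 : vadd x (vscale 0 d) = x by vext.
have e1 : vadd x (vscale 1 d) = y by rewrite -[RHS](vaddBK x) -/d; vext.
rewrite e0 e1 in eqc.
rewrite (_ : F y - F x - dot (DF x) d - / 2 * q =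
  dot (DF (vadd x (vscale c d))) d - dot (DF x) d - c * q) //.
by lra.
Qed.

(** The form used in the blow-up argument: base points, step lengths and directions all vary with
    k. *)
Lemma taylor2_seq n (F : vec n -> R) DF D2F x0 x t w w0 : C2_with F DF D2F x0 ->
  vlim x x0 -> is_lim_seq t 0 -> (forall k, 0 < t k) -> vlim w w0 ->
  is_lim_seq (fun k => (F (vadd (x k) (vscale (t k) (w k))) - F (x k)
    - t k * dot (DF (x k)) (w k)) / t k ^ 2) (/ 2 * quad (D2F x0) w0).
Proof.
move=> C2F xx0 t0 t_gt0 ww0.
pose u k := (F (vadd (x k) (vscale (t k) (w k))) - F (x k)
    - t k * dot (DF (x k)) (w k)) / t k ^ 2.
apply: (is_lim_seq_ext
    (fun k => (u k - / 2 * quad (D2F x0) (w k)) + / 2 * quad (D2F x0) (w k))).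
  by move=> k; rewrite /u; ring.
rewrite -[X in is_lim_seq _ (Finite X)]Rplus_0_l; apply: is_lim_seq_plus'; last first.
  apply: is_lim_seq_mult'; first exact: is_lim_seq_const.
  exact: lim_quad.
have [W [W_gt0 [N1 HN1]]] : exists W, 0 < W /\
    exists N, forall k, (N <= k)%coq_nat -> vnorm (w k) <= W.
  have [N HN] := lim_eventually (lim_vnorm ww0) Rlt_0_1.
  exists (vnorm w0 + 1); split; first by move: (vnorm_ge0 w0); lra.
  by exists N => k /HN /Rabs_lt_between; lra.
have yx0 : vlim (fun k => vadd (x k) (vscale (t k) (w k))) x0.
  have -> : x0 = vadd x0 (vscale 0 w0) by vext.
  exact/vlimD/vlimZ.
apply: lim_eps => eps eps_gt0.
(* The division by [W ^ 2] absorbs the factor |w k|^2 in |y - x|^2 = (t k |w k|)^2. *)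
have [|r [r_gt0 Hr]] := taylor2 C2F (eps := eps / W ^ 2).
  by apply: Rdiv_lt_0_compat => //; nra.
have [N2 HN2] := lim_eventually (vlim_dist xx0) r_gt0.
have [N3 HN3] := lim_eventually (vlim_dist yx0) r_gt0.
exists (Nat.max N1 (Nat.max N2 N3)) => k le_k.
have {HN1}w_le := HN1 k ltac:(lia).
have /Rabs_lt_between {HN2}x_r := HN2 k ltac:(lia).
have /Rabs_lt_between {HN3}y_r := HN3 k ltac:(lia).
have {Hr} := Hr (x k) (vadd (x k) (vscale (t k) (w k))) ltac:(lra) ltac:(lra).
rewrite vsubDK dotE vnormZ (Rabs_pos_eq (t k)); last by move: (t_gt0 k); lra.
rewrite quadZ.
have tk := t_gt0 k.
rewrite Rminus_0_r /u; set a := F _ - F _ - t k * _ => le_a.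
have -> : a / t k ^ 2 - / 2 * quad (D2F x0) (w k) =
  (a - / 2 * (t k ^ 2 * quad (D2F x0) (w k))) / t k ^ 2 by field; lra.
rewrite Rabs_div; last by apply: pow_nonzero; lra.
rewrite (Rabs_pos_eq (t k ^ 2)); last by nra.
apply: (Rmult_le_reg_r (t k ^ 2)); first by nra.
rewrite /Rdiv Rmult_assoc Rinv_l ?Rmult_1_r; last by apply: pow_nonzero; lra.
apply: Rle_trans le_a _.
have -> : eps / W ^ 2 * (t k * vnorm (w k)) ^ 2 =
  eps * t k ^ 2 * (vnorm (w k) ^ 2 / W ^ 2) by field; lra.
rewrite -[X in _ <= X]Rmult_1_r; apply: Rmult_le_compat_l; first by nra.
apply: (Rmult_le_reg_r (W ^ 2)); first by nra.
rewrite /Rdiv Rmult_assoc Rinv_l ?Rmult_1_r ?Rmult_1_l; last by apply: pow_nonzero; lra.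
by apply: pow_incr; split=> //; apply: vnorm_ge0.
Qed.

Lemma C2_grad_vlim n (F : vec n -> R) DF D2F x0 x : C2_with F DF D2F x0 ->
  vlim x x0 -> vlim (fun k => DF (x k)) (DF x0).
Proof.
move=> [r [r_gt0 HF]] xx0.
have [|_ [gDF _]] := HF x0.
  by rewrite (_ : vsub _ _ = @vzero n); [rewrite vnorm0|vext].
exact: has_grad_vlim gDF xx0.
Qed.

(** The difference quotient is the directional derivative plus t times the convergent second-order
    quotient. *)
Lemma diff_quotient_seq n (F : vec n -> R) DF D2F x0 x t w w0 : C2_with F DF D2F x0 ->
  vlim x x0 -> is_lim_seq t 0 -> (forall k, 0 < t k) -> vlim w w0 ->
  is_lim_seq (fun k => (F (vadd (x k) (vscale (t k) (w k))) - F (x k)) / t k)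
    (dot (DF x0) w0).
Proof.
move=> C2F xx0 t0 t_gt0 ww0.
have lim2 := taylor2_seq C2F xx0 t0 t_gt0 ww0.
have limD := lim_dot (C2_grad_vlim C2F xx0) ww0.
have := is_lim_seq_plus' _ _ _ _ limD (is_lim_seq_mult' _ _ _ _ t0 lim2).
rewrite Rmult_0_l Rplus_0_r; apply: is_lim_seq_ext => k.
by field; move: (t_gt0 k); lra.
Qed.

(** * Closed convex cones and multipliers for regular normals *)

Definition convex_cone {p} (K : vec p -> Prop) : Prop :=
  [/\ K (@vzero p), (forall a x, 0 <= a -> K x -> K (vscale a x))
    & (forall x y, K x -> K y -> K (vadd x y))].

Definition polar {p} (K : vec p -> Prop) (l : vec p) : Prop :=
  forall q, K q -> dot l q <= 0.

Lemma polar_closed p (K : vec p -> Prop) : vclosed (polar K).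
Proof.
move=> s l sl Ks q Kq.
have : Rbar_le (Finite (dot l q)) (Finite 0); last by [].
apply: (is_lim_seq_le (fun k => dot (s k) q) (fun=> 0)).
- by move=> k; apply: Ks.
- exact: (lim_dot sl (vlim_const q)).
- exact: is_lim_seq_const.
Qed.

(** This extracts a variational inequality from minimality along a segment: for small s the linear
    term dominates. *)
Lemma le0_of_quadratic a b :
  (forall s, 0 < s <= 1 -> 0 <= s * s * b - 2 * s * a) -> a <= 0.
Proof.
move=> H; apply: Rnot_lt_le => a_gt0.
have b_ge0 := Rabs_pos b; have b_le := Rle_abs b.
(* This s satisfies s b < 2 a, which makes the quadratic negative if a > 0. *)
pose s := Rmin 1 (a / (Rabs b + 1)).
have ab_gt0 : 0 < a / (Rabs b + 1) by apply: Rdiv_lt_0_compat; lra.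
have s_gt0 : 0 < s by apply: Rmin_pos; lra.
have sb : s * (Rabs b + 1) <= a.
  have -> : a = a / (Rabs b + 1) * (Rabs b + 1) by field; lra.
  by apply: Rmult_le_compat_r; [lra|apply: Rmin_r].
have := H s (conj s_gt0 (Rmin_l _ _)).
have : s * b < 2 * a by nra.
by nra.
Qed.

(** Moreau decomposition. Restricting to |a - q| <= |a| makes the search set compact and keeps 0 in
    it; the points cut off are farther from a than the minimizer. *)
Lemma cone_projection p (K : vec p -> Prop) a : convex_cone K -> vclosed K ->
  exists pi, [/\ K pi, polar K (vsub a pi), dot (vsub a pi) pi = 0
    & forall z, K z -> vnorm (vsub a pi) <= vnorm (vsub a z)].
Proof.
move=> [K0 KZ KD] clK.
have [||||pi [[Kpi pi_le] pi_min]] := @vec_minimum_exists p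
  (fun q => K q /\ vnorm (vsub a q) <= vnorm a) (fun q => vnorm (vsub a q))
  (2 * vnorm a) (@vzero p).
- move=> s x sx Hs; split; first by apply: clK sx _ => k; case: (Hs k).
  have : Rbar_le (Finite (vnorm (vsub a x))) (Finite (vnorm a)); last by [].
  apply: (is_lim_seq_le (fun k => vnorm (vsub a (s k))) (fun=> vnorm a)).
  + by move=> k; case: (Hs k).
  + exact/lim_vnorm/vlimB/sx/vlim_const.
  + exact: is_lim_seq_const.
- move=> q [_ q_le].
  have -> : q = vsub a (vsub a q) by vext.
  have := vdist_triangle a (@vzero p) (vsub a q).
  rewrite (_ : vsub a (@vzero p) = a); last by vext.
  rewrite (vnormBC (@vzero p)) (_ : vsub (vsub a q) _ = vsub a q); last by vext.
  by lra.
- split=> //; rewrite (_ : vsub a _ = a); [lra|by vext].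
- by move=> s x sx _ _; apply/lim_vnorm/vlimB/sx/vlim_const.
have proj z : K z -> vnorm (vsub a pi) <= vnorm (vsub a z).
  move=> Kz; case: (Rle_dec (vnorm (vsub a z)) (vnorm a)) => ?; first exact: pi_min.
  by lra.
have proj2 z : K z ->
    dot (vsub a pi) (vsub a pi) <= dot (vsub a z) (vsub a z).
  by move=> /proj; rewrite -!vnorm_mul; have := vnorm_ge0 (vsub a pi); nra.
have pol : polar K (vsub a pi).
  move=> q Kq; apply: (@le0_of_quadratic _ (dot q q)) => s s01.
  have := proj2 _ (KD _ _ Kpi (KZ s q ltac:(lra) Kq)).
  by rewrite !dotE (dotC q a) (dotC q pi) (dotC pi a); lra.
(* Polarity tested on pi itself gives one sign; shrinking pi to (1 - s) pi, which stays in the cone,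
   gives the other. *)
exists pi; split=> //; apply: Rle_antisym; first exact: pol.
rewrite -(Ropp_involutive (dot _ _)) -[X in X <= _]Ropp_0; apply: Ropp_le_contravar.
apply: (@le0_of_quadratic _ (dot pi pi)) => s s01.
have := proj2 _ (KZ (1 - s) pi ltac:(lra) Kpi).
by rewrite !dotE (dotC pi a); nra.
Qed.

Lemma has_grad_vec n p (G : vec n -> vec p) x A :
  (forall i, has_grad (fun y => G y i) x (A i)) ->
  forall eps, 0 < eps -> exists r, 0 < r /\ forall h, vnorm h < r ->
    vnorm (vsub (vsub (G (vadd x h)) (G x)) (jac_r A h)) <= eps * vnorm h.
Proof.
move=> gG eps eps_gt0; have p_ge0 := pos_INR p.
pose e := eps / (INR p + 1).
have e_gt0 : 0 < e by apply: Rdiv_lt_0_compat; lra.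
have [i|i d d' Hd led h ?|r [r_gt0 Hr]] := @ord_common_radius p (fun i r =>
  forall h, vnorm h < r ->
    Rabs (G (vadd x h) i - G x i - dot (A i) h) <= e * vnorm h).
- by have [r [r_gt0 Hr]] := gG i e e_gt0; exists r.
- by apply: Hd; lra.
exists r; split=> // h h_r; have h_ge0 := vnorm_ge0 h.
apply: Rle_trans (@vnorm_le_coord _ _ (e * vnorm h) _ _) _.
- by nra.
- by move=> i; apply: Hr.
have -> : eps = (INR p + 1) * e by rewrite /e; field; lra.
by nra.
Qed.

Lemma le_of_le_eps a b c : (forall eps, 0 < eps <= 1 -> a <= b + c * eps) -> a <= b.
Proof.
move=> H; apply: Rnot_lt_le => lt_ba.
have c_ge0 := Rabs_pos c; have c_le := Rle_abs c.
pose e := Rmin 1 ((a - b) / (2 * (Rabs c + 1))).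
have e_gt0 : 0 < e by apply: Rmin_pos; [lra|apply: Rdiv_lt_0_compat; lra].
have := H e (conj e_gt0 (Rmin_l _ _)).
have : e * (2 * (Rabs c + 1)) <= a - b.
  have -> : a - b = (a - b) / (2 * (Rabs c + 1)) * (2 * (Rabs c + 1)) by field; lra.
  by apply: Rmult_le_compat_r; [lra|apply: Rmin_r].
by nra.
Qed.

(* Projecting the linearised path [G x + t A h] onto K, the scaled residuals
   [r_k] cluster at a normal r to K at G x with [|r|^2 <= <r, A h>], and
   the error bound turns [t |r_k|] into a bound on the distance to the feasible set. *)
Lemma normal_dual_bound n p (K : vec p -> Prop) (G : vec n -> vec p) A x v sigma rho h :
  convex_cone K -> vclosed K ->
  (forall i, has_grad (fun y => G y i) x (A i)) -> 0 < rho -> 0 <= sigma ->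
  (forall y q, vnorm (vsub y x) < rho -> K q ->
     exists z, K (G z) /\ vnorm (vsub y z) <= sigma * vnorm (vsub (G y) q)) ->
  reg_normal (fun y => K (G y)) x v ->
  exists l, [/\ polar K l, dot l (G x) = 0, vnorm l <= sigma * vnorm v
    & dot v h <= dot l (jac_r A h)].
Proof.
move=> cK clK gG rho_gt0 sigma_ge0 errb [KGx nv].
have [K0 KZ KD] := cK.
set z := G x; set q := jac_r A h.
have H k : exists r, [/\ vnorm r <= vnorm q, polar K r,
    dot r (vsub (vadd z (vscale (inv_succ k) q)) (vscale (inv_succ k) r)) = 0,
    dot r r <= dot r q
    & K (vsub (vadd z (vscale (inv_succ k) q)) (vscale (inv_succ k) r))].
  have tk := inv_succ_gt0 k; set t := inv_succ k.
  set a := vadd z (vscale t q).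
  have [pi [Kpi pol orth near]] := cone_projection a cK clK.
  pose r := vscale (/ t) (vsub a pi).
  have pi_r : vsub a (vscale t r) = pi.
    rewrite /r; apply: functional_extensionality => i.
    by rewrite /vsub /vscale; field; rewrite /t; lra.
  have ti : 0 < / t by apply: Rinv_0_lt_compat.
  have polr : polar K r.
    by move=> q' /pol; rewrite /r dotZl; nra.
  have orthr : dot r pi = 0 by rewrite /r dotZl orth; ring.
  exists r; rewrite pi_r; split=> //.
  (* z lies in K, so the projection of z + t q is at distance at most t |q|. *)
  - have := near z KGx; rewrite {2}/a vsubDK vnormZ Rabs_pos_eq => [le_r|]; last by apply: Rlt_le.
    rewrite /r vnormZ Rabs_pos_eq; last lra.
    apply: (Rmult_le_reg_l t) => //.
    by rewrite -Rmult_assoc Rinv_r ?Rmult_1_l //; rewrite /t; lra.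
  (* r is orthogonal to the projection z + t q - t r, while <r, z> <= 0. *)
  - clearbody r; have := polr z KGx; have := orthr; rewrite -pi_r /a !dotE.
    move=> e le0; have : t * dot r r <= t * dot r q by lra.
    exact: Rmult_le_reg_l.
have [r Hr] := choice_fun H.
have [k|phi [r0 [ephi rr0]]] := @Bolzano_Weierstrass_vec _ r (vnorm q).
  by case: (Hr k).
have t0 := lim_extraction ephi lim_inv_succ.
have pol0 : polar K r0.
  by apply: polar_closed rr0 _ => k; case: (Hr (phi k)).
have orth0 : dot r0 z = 0.
  have lim1 := vlimD (vlim_const z) (vlimZ t0 (vlim_const q)).
  have lim2 := lim_dot rr0 (vlimB lim1 (vlimZ t0 rr0)).
  have := is_lim_seq_unique _ _ lim2.
  rewrite !dotE (Lim_seq_ext _ (fun=> 0)); last by move=> k; case: (Hr (phi k)).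
  by rewrite Lim_seq_const => -[]; lra.
have le0 : dot r0 r0 <= dot r0 q.
  have : Rbar_le (Finite (dot r0 r0)) (Finite (dot r0 q)); last by [].
  apply: is_lim_seq_le (lim_dot rr0 rr0) (lim_dot rr0 (vlim_const q)) => k.
  by case: (Hr (phi k)).
(* Given this bound, the multiplier is r0 rescaled to norm sigma |v|, and |r0|^2 <= <r0, q> gives
   the last inequality. If r0 = 0 the multiplier 0 works. *)
suff vh : dot v h <= sigma * vnorm v * vnorm r0.
  have sv_ge0 : 0 <= sigma * vnorm v by have := vnorm_ge0 v; nra.
  have [r00|r0_neq0] := Req_dec (vnorm r0) 0.
    exists (@vzero p); rewrite r00 Rmult_0_r in vh.
    by split; rewrite ?dot0l ?vnorm0 //; move=> q' _; rewrite dot0l; lra.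
  have r0_gt0 : 0 < vnorm r0 by have := vnorm_ge0 r0; lra.
  have ir0_gt0 := Rinv_0_lt_compat _ r0_gt0.
  exists (vscale (sigma * vnorm v / vnorm r0) r0).
  have c_ge0 : 0 <= sigma * vnorm v / vnorm r0 by apply: Rmult_le_pos => //; lra.
  split.
  - by move=> q' /pol0; rewrite dotZl; nra.
  - by rewrite dotZl orth0; ring.
  - rewrite vnormZ Rabs_pos_eq // /Rdiv Rmult_assoc Rinv_l //; lra.
  - rewrite dotZl; apply: Rle_trans vh _.
    have -> : sigma * vnorm v * vnorm r0 = sigma * vnorm v / vnorm r0 * dot r0 r0.
      by rewrite -vnorm_mul; field.
    exact: Rmult_le_compat_l.
have hh := vnorm_ge0 h; have vv := vnorm_ge0 v; have qq := vnorm_ge0 q.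
have rr := vnorm_ge0 r0.
apply: (@le_of_le_eps _ _ (sigma * vnorm v * (1 + vnorm h)
  + (vnorm h + sigma * (vnorm r0 + 1 + vnorm h)))) => eps eps01.
have [r1 [r1_gt0 Hr1]] := nv eps eps01.1.
have [r2 [r2_gt0 Hr2]] := has_grad_vec gG eps01.1.
(* t c bounds both |t h| and the distance from x to the feasible point y chosen below, so t c below
   all three radii keeps both points where the estimates hold. *)
pose c := vnorm h + sigma * (vnorm r0 + 1 + vnorm h) + 1.
have c_gt0 : 0 < c by rewrite /c; nra.
have m_gt0 : 0 < Rmin rho (Rmin r1 r2) by do ?apply: Rmin_pos.
have [N1 HN1] := lim_eventually (lim_vnorm rr0) eps01.1.
have [N2 HN2] := lim_eventually t0 (Rdiv_lt_0_compat _ _ m_gt0 c_gt0).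
pose k := Nat.max N1 N2.
have /Rabs_lt_between {HN1}r_k := HN1 k ltac:(lia).
have /Rabs_lt_between {HN2}t_k := HN2 k ltac:(lia).
have [_ _ _ _ Kk] := Hr (phi k).
have t_gt0 := inv_succ_gt0 (phi k).
move: r_k t_k t_gt0 Kk; set t := inv_succ _; set rk := r _ => r_k t_k t_gt0 Kk.
have tc : t * c < Rmin rho (Rmin r1 r2).
  have : t < Rmin rho (Rmin r1 r2) / c by lra.
  by move/(Rmult_lt_compat_r c _ _ c_gt0); rewrite /Rdiv Rmult_assoc Rinv_l; lra.
have m1 := Rmin_l rho (Rmin r1 r2); have m2 := Rmin_r rho (Rmin r1 r2).
have m3 := Rmin_l r1 r2; have m4 := Rmin_r r1 r2.
have th_le : t * vnorm h <= t * c.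
  apply: Rmult_le_compat_l; first lra; rewrite /c; nra.
have nth : vnorm (vscale t h) = t * vnorm h by rewrite vnormZ Rabs_pos_eq; lra.
(* The error bound compares G(x + t h) with the projected point of the linearised path: their
   distance is at most t |r_k| plus the linearisation error eps t |h|. *)
have [|y [Ky xy]] := errb (vadd x (vscale t h)) _ _ Kk.
  by rewrite vsubDK nth; lra.
have {}xy : vnorm (vsub (vadd x (vscale t h)) y) <=
    t * (sigma * (vnorm r0 + eps * (1 + vnorm h))).
  apply: Rle_trans xy _.
  rewrite (_ : t * _ = sigma * (t * (vnorm r0 + eps * (1 + vnorm h)))); last ring.
  apply: Rmult_le_compat_l => //.
  set gy := G _.
  have -> : vsub gy (vsub (vadd z (vscale t q)) (vscale t rk)) =
    vadd (vsub (vsub gy z) (vscale t q)) (vscale t rk) by vext.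
  apply: Rle_trans (vnormD _ _) _.
  have := Hr2 (vscale t h) ltac:(lra).
  rewrite (_ : jac_r A _ = vscale t q) => [|]; last first.
    by apply: functional_extensionality => i; rewrite /jac_r dotZr.
  rewrite -/gy -/z nth (vnormZ t rk) (Rabs_pos_eq t); last lra.
  by move=> ?; nra.
set D := sigma * (vnorm r0 + eps * (1 + vnorm h)) in xy.
have D_ge0 : 0 <= D by rewrite /D; apply: Rmult_le_pos => //; nra.
have D_le : D <= sigma * (vnorm r0 + 1 + vnorm h).
  by rewrite /D; apply: Rmult_le_compat_l => //; nra.
have yx : vnorm (vsub y x) <= t * (vnorm h + D).
  have := vdist_triangle y (vadd x (vscale t h)) x.
  by rewrite vsubDK nth (vnormBC y (vadd _ _)); lra.
have yx_r1 : vnorm (vsub y x) < r1.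
  have : t * (vnorm h + D) <= t * c by apply: Rmult_le_compat_l; rewrite ?/c; lra.
  by lra.
have := Hr1 y Ky yx_r1.
have := dot_le_vnorm v (vsub (vadd x (vscale t h)) y).
rewrite !dotE => le1 le2.
have {}le1 : t * dot v h <= vnorm v * (t * D) + eps * (t * (vnorm h + D)).
  have : vnorm v * vnorm (vsub (vadd x (vscale t h)) y) <= vnorm v * (t * D).
    exact: Rmult_le_compat_l.
  have : eps * vnorm (vsub y x) <= eps * (t * (vnorm h + D)).
    by apply: Rmult_le_compat_l; lra.
  by lra.
have {le2}le1 : dot v h <= vnorm v * D + eps * (vnorm h + D).
  by apply: (Rmult_le_reg_l t) => //; lra.
apply: Rle_trans le1 _.
have : eps * (vnorm h + D) <= eps * (vnorm h + sigma * (vnorm r0 + 1 + vnorm h)).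
  by apply: Rmult_le_compat_l; lra.
have -> : vnorm v * D = sigma * vnorm v * vnorm r0 +
  sigma * vnorm v * (1 + vnorm h) * eps by rewrite /D; ring.
by lra.
Qed.

(* The least-squares multiplier over the compact convex set of admissible ones has
   zero residual h: testing [normal_dual_bound] on h gives [|h|^2 <= 0]. *)
Lemma normal_multiplier n p (K : vec p -> Prop) (G : vec n -> vec p) A x v sigma rho :
  convex_cone K -> vclosed K ->
  (forall i, has_grad (fun y => G y i) x (A i)) -> 0 < rho -> 0 <= sigma ->
  (forall y q, vnorm (vsub y x) < rho -> K q ->
     exists z, K (G z) /\ vnorm (vsub y z) <= sigma * vnorm (vsub (G y) q)) ->
  reg_normal (fun y => K (G y)) x v ->
  exists l, [/\ polar K l, dot l (G x) = 0, vnorm l <= sigma * vnorm v & v = adj A l].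
Proof.
move=> cK clK gG rho_gt0 sigma_ge0 errb nv.
pose M := sigma * vnorm v.
have M_ge0 : 0 <= M by have := vnorm_ge0 v; rewrite /M; nra.
pose C l := [/\ polar K l, dot l (G x) = 0 & vnorm l <= M].
have [||||l [Cl l_min]] := @vec_minimum_exists p C
    (fun l => vnorm (vsub v (adj A l))) M (@vzero p).
- move=> s l sl Cs; split.
  + by apply: polar_closed sl _ => k; case: (Cs k).
  + have := is_lim_seq_unique _ _ (lim_dot sl (vlim_const (G x))).
    rewrite (Lim_seq_ext _ (fun=> 0)); last by move=> k; case: (Cs k).
    by rewrite Lim_seq_const => -[].
  + have : Rbar_le (Finite (vnorm l)) (Finite M); last by [].
    apply: is_lim_seq_le (lim_vnorm sl) (is_lim_seq_const M) => k.
    by case: (Cs k).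
- by move=> l [].
- by split; rewrite ?dot0l ?vnorm0 // => q _; rewrite dot0l; lra.
- move=> s l sl _ _; apply/lim_vnorm/vlimB; first exact: vlim_const.
  by apply: vlim_adj => // i; apply: vlim_const.
have [pol_l orth_l l_le] := Cl.
exists l; split=> //.
set h := vsub v (adj A l) in l_min.
have [l' [pol_l' orth_l' l'_le vh]] :=
  normal_dual_bound h cK clK gG rho_gt0 sigma_ge0 errb nv.
apply/vsub_eq0/vnorm_eq0; rewrite -/h.
(* Minimality gives <l' - l, A h> <= 0 for every admissible l'. For the l' dual to h, |h|^2 = <v, h>
   - <l, A h> <= <l' - l, A h>. *)
suff opt : dot l' (jac_r A h) - dot l (jac_r A h) <= 0.
  have hh : dot h h = dot v h - dot l (jac_r A h) by rewrite {1}/h dotBl dot_adj.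
  by have := vnorm_mul h; have := vnorm_ge0 h; nra.
pose d := adj A (vsub l' l).
have -> : dot l' (jac_r A h) - dot l (jac_r A h) = dot d h.
  by rewrite /d dot_adj dotBl.
apply: (@le0_of_quadratic _ (dot d d)) => s s01.
have Cs : C (vadd (vscale (1 - s) l) (vscale s l')).
  split.
  - by move=> q Kq; rewrite !dotE; have := pol_l q Kq; have := pol_l' q Kq; nra.
  - by rewrite !dotE orth_l orth_l'; ring.
  - apply: Rle_trans (vnormD _ _) _; rewrite !vnormZ !Rabs_pos_eq; try lra.
    by rewrite -/M in l'_le; nra.
have := l_min _ Cs.
have -> : vsub v (adj A (vadd (vscale (1 - s) l) (vscale s l'))) =
    vsub h (vscale s d).
  apply: dot_inj => u; rewrite /h /d !(dotE, dot_adj); ring.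
move=> le_h; have : dot h h <= dot (vsub h (vscale s d)) (vsub h (vscale s d)).
  by rewrite -!vnorm_mul; have := vnorm_ge0 h; nra.
by clearbody h d; rewrite !dotE (dotC h d); lra.
Qed.

(** * The second-order cone and its polar *)

Definition vcons {A : Type} {m} (a : A) (x : 'I_m -> A) : 'I_m.+1 -> A :=
  fun i => oapp x a (unlift ord0 i).

Definition vtail {m} (q : vec m.+1) : vec m := fun j => q (lift ord0 j).

(** The scalar component is stored at [ord0] of a single vector, so that the results for general
    closed convex cones apply. *)
Definition soc {m} (q : vec m.+1) : Prop := vnorm (vtail q) <= q ord0.

Lemma vcons0 A m (a : A) (x : 'I_m -> A) : vcons a x ord0 = a.
Proof. by rewrite /vcons unlift_none. Qed.

Lemma vconsS A m (a : A) (x : 'I_m -> A) j : vcons a x (lift ord0 j) = x j.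
Proof. by rewrite /vcons liftK. Qed.

Lemma vtail_cons m (a : R) (x : vec m) : vtail (vcons a x) = x.
Proof. by apply: functional_extensionality => j; rewrite /vtail vconsS. Qed.

Lemma vec_eta m (q : vec m.+1) : q = vcons (q ord0) (vtail q).
Proof.
apply: functional_extensionality => i.
by case: (unliftP ord0 i) => [j ->|->]; rewrite ?vconsS ?vcons0.
Qed.

Lemma dot_recl m (x y : vec m.+1) :
  dot x y = x ord0 * y ord0 + dot (vtail x) (vtail y).
Proof. by rewrite /dot big_ord_recl. Qed.

Lemma soc_ge0 m (q : vec m.+1) : soc q -> 0 <= q ord0.
Proof. by rewrite /soc; have := vnorm_ge0 (vtail q); lra. Qed.

Lemma soc_convex_cone m : convex_cone (@soc m).
Proof.
split.
- rewrite /soc (_ : vtail _ = @vzero m) // vnorm0.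
  by rewrite /vzero; lra.
- move=> a q a_ge0; rewrite /soc (_ : vtail (vscale a q) = vscale a (vtail q)) //.
  rewrite vnormZ Rabs_pos_eq // => Kq.
  by have := Rmult_le_compat_l a _ _ a_ge0 Kq.
- move=> x y; rewrite /soc (_ : vtail (vadd x y) = vadd (vtail x) (vtail y)) //.
  by have := vnormD (vtail x) (vtail y); rewrite [vadd x y ord0]/vadd; lra.
Qed.

Lemma vlim_tail m (s : nat -> vec m.+1) q : vlim s q ->
  vlim (fun k => vtail (s k)) (vtail q).
Proof. by move=> sq j; apply: sq. Qed.

Lemma soc_closed m : vclosed (@soc m).
Proof.
move=> s q sq Ks.
have : Rbar_le (Finite (vnorm (vtail q))) (Finite (q ord0)); last by [].
exact: is_lim_seq_le Ks (lim_vnorm (vlim_tail sq)) (sq ord0).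
Qed.

(** Testing on the boundary vector (|l_r|, l_r) gives |l_r| (l_0 + |l_r|) <= 0. When l_r = 0 this
    says nothing, and (1, 0) is tested instead. *)
Lemma polar_soc m (l : vec m.+1) : polar soc l -> vnorm (vtail l) <= - l ord0.
Proof.
move=> pol; have lr_ge0 := vnorm_ge0 (vtail l).
have [lr0|lr_neq0] := Req_dec (vnorm (vtail l)) 0.
  have := pol (vcons 1 (@vzero m)).
  rewrite /soc dot_recl vtail_cons vcons0 dot0r vnorm0 lr0.
  by move=> /(_ Rle_0_1); lra.
have := pol (vcons (vnorm (vtail l)) (vtail l)).
rewrite /soc dot_recl vtail_cons vcons0 -vnorm_mul => /(_ (Rle_refl _)).
by nra.
Qed.

(* A quantitative form of complementarity: if [<l, z> = 0], then z_r is
   parallel to l_r. *)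
Lemma soc_complementarity m (l z : vec m.+1) : polar soc l -> soc z ->
  dot (vsub (vscale (- l ord0) (vtail z)) (vscale (z ord0) (vtail l)))
      (vsub (vscale (- l ord0) (vtail z)) (vscale (z ord0) (vtail l)))
    <= 2 * (- l ord0) * z ord0 * (- dot l z).
Proof.
move=> pol Kz; have lr := polar_soc pol.
have z0 := soc_ge0 Kz; move: Kz; rewrite /soc => zr.
have nz := vnorm_ge0 (vtail z); have nl := vnorm_ge0 (vtail l).
rewrite !dotE (dotC (vtail z) (vtail l)) -!vnorm_mul dot_recl.
set b := - l ord0 in lr *; have -> : l ord0 = - b by rewrite /b; ring.
(* Both squares in the expansion are at most (b z_0)^2; what remains is 2 b z_0 (b z_0 - <l_r,
   z_r>). *)
have : (b * vnorm (vtail z)) ^ 2 <= (b * z ord0) ^ 2.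
  by apply: pow_incr; split; [nra|apply: Rmult_le_compat_l; lra].
have : (z ord0 * vnorm (vtail l)) ^ 2 <= (z ord0 * b) ^ 2.
  by apply: pow_incr; split; [nra|apply: Rmult_le_compat_l; lra].
by nra.
Qed.

Lemma soc_orthogonal_parallel m (l z : vec m.+1) : polar soc l -> soc z ->
  dot l z = 0 -> vscale (- l ord0) (vtail z) = vscale (z ord0) (vtail l).
Proof.
move=> pol Kz lz0; apply/vsub_eq0/vnorm_eq0.
have := soc_complementarity pol Kz; rewrite lz0 -vnorm_mul.
by have := vnorm_ge0 (vsub (vscale (- l ord0) (vtail z)) (vscale (z ord0) (vtail l))); nra.
Qed.

(** * Stationary pairs with multipliers, and uniform growth *)

Lemma vlim_bounded n (s : nat -> vec n) x : vlim s x ->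
  exists M, forall k, vnorm (s k) <= M.
Proof.
move=> /lim_vnorm/is_lim_seq_Reals sx.
have [M [_ HM]] := maj_by_pos _ (exist _ _ sx).
by exists M => k; rewrite -(Rabs_pos_eq _ (vnorm_ge0 _)).
Qed.

Lemma vlim_of_inv_succ n (s : nat -> vec n) x :
  (forall k, vnorm (vsub (s k) x) <= inv_succ k) -> vlim s x.
Proof.
move=> sx; apply: vlim_of_dist; apply: lim_le_inv_succ => k.
by rewrite Rminus_0_r Rabs_pos_eq //; apply: vnorm_ge0.
Qed.

(** Stationarity of x for f - <v, .> over the feasible set, in multiplier form. [KKT_bound] makes
    multipliers of convergent pairs bounded, and it singles out l = 0 when the gradient of f
    vanishes at xbar. *)
Record KKT {n m} (Df : vec n -> vec n) (G : vec n -> vec m.+1)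
    (DG : vec n -> 'I_m.+1 -> vec n) (s : R) (x v : vec n) (l : vec m.+1) : Prop := {
  KKT_feasible : soc (G x);
  KKT_polar : polar soc l;
  KKT_compl : dot l (G x) = 0;
  KKT_bound : vnorm l <= s * vnorm (vsub v (Df x));
  KKT_grad : vsub v (Df x) = adj (DG x) l }.

Lemma KKT_limit n m f Df D2f (G : vec n -> vec m.+1) DG D2G xbar s
    (x v : nat -> vec n) l l0 v0 :
  C2_with f Df D2f xbar ->
  (forall i, C2_with (fun x => G x i) (fun x => DG x i) (fun x => D2G x i) xbar) ->
  (forall k, KKT Df G DG s (x k) (v k) (l k)) ->
  vlim x xbar -> vlim v v0 -> vlim l l0 -> KKT Df G DG s xbar v0 l0.
Proof.
move=> C2f C2G kkt xx vv ll.
have GG : vlim (fun k => G (x k)) (G xbar).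
  apply: (has_grad_vlim _ xx) => i; have [r [r_gt0 Hr]] := C2G i.
  have [|gG _] := Hr xbar; last exact: gG.
  by rewrite (_ : vsub _ _ = @vzero n); [rewrite vnorm0|vext].
have DD : vlim (fun k => vsub (v k) (Df (x k))) (vsub v0 (Df xbar)).
  exact/vlimB/(C2_grad_vlim C2f xx).
split.
- by apply: soc_closed GG _ => k; case: (kkt k).
- by apply: polar_closed ll _ => k; case: (kkt k).
- have := is_lim_seq_unique _ _ (lim_dot ll GG).
  rewrite (Lim_seq_ext _ (fun=> 0)); last by move=> k; case: (kkt k).
  by rewrite Lim_seq_const => -[].
- have : Rbar_le (Finite (vnorm l0)) (Finite (s * vnorm (vsub v0 (Df xbar)))); last by [].
  apply: is_lim_seq_le (lim_vnorm ll) _; last first.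
    apply: is_lim_seq_mult'; first exact: is_lim_seq_const.
    exact: lim_vnorm DD.
  by move=> k; case: (kkt k).
- apply: vlim_unique DD _ => i.
  have := @vlim_adj _ _ (fun k => DG (x k)) (DG xbar) l l0 _ ll i.
  move=> /(_ (fun j => C2_grad_vlim (C2G j) xx)); apply: is_lim_seq_ext => k.
  by case: (kkt k) => _ _ _ _ ->.
Qed.

Lemma lim_squeeze0 u v : is_lim_seq v 0 -> (forall k, 0 <= u k <= v k) ->
  is_lim_seq u 0.
Proof.
move=> v0 uv; apply: lim_seq_sandwich0 v0 _ => k.
by rewrite Rminus_0_r Rabs_pos_eq; case: (uv k).
Qed.

(* If growth with constant [1/(2 kappa)] failed along a sequence, the multiplier gap
   [- <l_k, G y_k> / t_k^2] would stay bounded; then the limit direction w0 is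
   critical and the Taylor expansion of the Lagrangian contradicts the second-order
   condition at w0. *)
Lemma growth_failure_direction n m (f : vec n -> R) Df D2f (G : vec n -> vec m.+1) DG D2G
    xbar s kappa (x w v : nat -> vec n) (t : nat -> R) l w0 l0 :
  C2_with f Df D2f xbar ->
  (forall i, C2_with (fun x => G x i) (fun x => DG x i) (fun x => D2G x i) xbar) ->
  G xbar ord0 = 0 ->
  vlim x xbar -> (forall k, 0 < t k) -> is_lim_seq t 0 ->
  vlim w w0 -> vlim l l0 ->
  (forall k, KKT Df G DG s (x k) (v k) (l k)) ->
  (forall k, soc (G (vadd (x k) (vscale (t k) (w k))))) ->
  (forall k, f (vadd (x k) (vscale (t k) (w k))) <
     f (x k) + t k * dot (v k) (w k) + t k ^ 2 / (2 * kappa)) ->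
  [/\ dot l0 (jac_r (DG xbar) w0) = 0,
      l0 ord0 * (vnorm (vtail (jac_r (DG xbar) w0)) ^ 2
                 - jac_r (DG xbar) w0 ord0 ^ 2) = 0
    & quad (D2f xbar) w0 + dot l0 (fun i => quad (D2G xbar i) w0) <= / kappa].
Proof.
move=> C2f C2G G0 xx t_gt0 t0 ww ll kkt Ky lt_f.
pose y k := vadd (x k) (vscale (t k) (w k)).
pose a k := (f (y k) - f (x k) - t k * dot (Df (x k)) (w k)) / t k ^ 2.
pose b k : vec m.+1 := fun i =>
  (G (y k) i - G (x k) i - t k * dot (DG (x k) i) (w k)) / t k ^ 2.
pose c k := - dot (l k) (G (y k)) / t k ^ 2.
have lim_a : is_lim_seq a (/ 2 * quad (D2f xbar) w0) by apply: taylor2_seq.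
have lim_b : vlim b (fun i => / 2 * quad (D2G xbar i) w0).
  by move=> i; apply: (taylor2_seq (C2G i)).
have lim_S := is_lim_seq_plus' _ _ _ _ lim_a (lim_dot ll lim_b).
have t2_gt0 k : 0 < t k ^ 2 by apply: pow_lt.
have c_ge0 k : 0 <= c k.
  apply: Rmult_le_pos; last by apply/Rlt_le/Rinv_0_lt_compat.
  by have := KKT_polar (kkt k) (Ky k); rewrite -/(y k); lra.
(* The first-order terms cancel by [KKT_grad] and [KKT_compl]; what is left is the failed growth
   inequality divided by [t k ^ 2]. *)
have abc k : a k + dot (l k) (b k) + c k < / (2 * kappa).
  have tk := t_gt0 k; have t2 := t2_gt0 k.
  have b_eq : vscale (t k ^ 2) (b k) =
    vsub (vsub (G (y k)) (G (x k))) (vscale (t k) (jac_r (DG (x k)) (w k))).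
    by apply: functional_extensionality => i; rewrite /b /vsub /vscale /jac_r; field; lra.
  have lb : t k ^ 2 * dot (l k) (b k) =
      dot (l k) (G (y k)) - t k * dot (vsub (v k) (Df (x k))) (w k).
    rewrite (KKT_grad (kkt k)) dot_adj -dotZr b_eq !dotE (KKT_compl (kkt k)); ring.
  apply: (Rmult_lt_reg_l (t k ^ 2)) => //.
  have -> : t k ^ 2 * (a k + dot (l k) (b k) + c k) =
      t k ^ 2 * a k + t k ^ 2 * dot (l k) (b k) - dot (l k) (G (y k)).
    by rewrite /c; field; lra.
  rewrite lb dotBl (_ : t k ^ 2 * a k = f (y k) - f (x k) - t k * dot (Df (x k)) (w k)).
    by have := lt_f k; rewrite -/(y k) /Rdiv; lra.
  by rewrite /a; field; lra.
(* a + <l, b> converges, hence is bounded, so the nonnegative gap c is bounded above. *)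
have [B HB] : exists B, forall k, c k <= B.
  have [B [_ HB]] := maj_by_pos _ (exist _ _ ((is_lim_seq_Reals _ _).1 lim_S)).
  exists (/ (2 * kappa) + B) => k; have := abc k.
  by have /Rabs_le_between := HB k; lra.
pose P k := vscale (/ t k) (vsub (G (y k)) (G (x k))).
have lim_P : vlim P (jac_r (DG xbar) w0).
  move=> i; apply: is_lim_seq_ext (diff_quotient_seq (C2G i) xx t0 t_gt0 ww) => k.
  by rewrite /P /vscale /vsub Rmult_comm.
have yx : vlim y xbar.
  have -> : xbar = vadd xbar (vscale 0 w0) by vext.
  exact/vlimD/vlimZ.
have lim_G0 : is_lim_seq (fun k => G (y k) ord0) 0.
  rewrite -G0; have [r [r_gt0 Hr]] := C2G ord0.
  have [|gG _] := Hr xbar; last exact: has_grad_lim gG yx.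
  by rewrite (_ : vsub _ _ = @vzero n); [rewrite vnorm0|vext].
have crit1 : dot l0 (jac_r (DG xbar) w0) = 0.
  have lim0 : is_lim_seq (fun k => - dot (l k) (P k)) 0.
    apply: (@lim_squeeze0 _ (fun k => B * t k)).
      rewrite -[X in is_lim_seq _ (Finite X)](Rmult_0_r B).
      exact/is_lim_seq_mult'/t0/is_lim_seq_const.
    move=> k; have tk := t_gt0 k; have ck := c_ge0 k; have Bk := HB k.
    have -> : - dot (l k) (P k) = c k * t k.
      by rewrite /c /P !dotE (KKT_compl (kkt k)); field; lra.
    by nra.
  have := is_lim_seq_unique _ _ lim0.
  rewrite (is_lim_seq_unique _ _ ((is_lim_seq_opp _ _).1 (lim_dot ll lim_P))) => -[].
  by lra.
pose e k := vsub (vscale (- l k ord0) (vtail (P k))) (vscale (P k ord0) (vtail (l k))).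
have lim_l0 : is_lim_seq (fun k => - l k ord0) (- l0 ord0).
  exact: (is_lim_seq_opp _ _).1 (ll ord0).
have lim_e := vlimB (vlimZ lim_l0 (vlim_tail lim_P)) (vlimZ (lim_P ord0) (vlim_tail ll)).
(* At x k the parallelism is exact, so subtracting it turns e k into the defect at y k divided by t
   k. Its square is then at most 2 (- l_0) G_0(y k) c k, which tends to 0 with G_0(y k). *)
have par : vscale (- l0 ord0) (vtail (jac_r (DG xbar) w0)) =
    vscale (jac_r (DG xbar) w0 ord0) (vtail l0).
  apply/vsub_eq0/vnorm_eq0; rewrite /vnorm.
  have lim0 : is_lim_seq (fun k => dot (e k) (e k)) 0.
    apply: (@lim_squeeze0 _ (fun k => 2 * (- l k ord0) * G (y k) ord0 * B)).
      rewrite (_ : 0 = 2 * (- l0 ord0) * 0 * B); last ring.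
      apply: is_lim_seq_mult'; last exact: is_lim_seq_const.
      apply: is_lim_seq_mult' => //; apply: is_lim_seq_mult' => //.
      exact: is_lim_seq_const.
    move=> k; split; first exact: dot_ge0.
    have tk := t_gt0 k; have t2 := t2_gt0 k.
    have [Kx pol compl _ _] := kkt k.
    have px := soc_orthogonal_parallel pol Kx compl.
    have -> : e k = vscale (/ t k) (vsub (vscale (- l k ord0) (vtail (G (y k))))
                      (vscale (G (y k) ord0) (vtail (l k)))).
      apply: functional_extensionality => i.
      have := congr1 (fun q => q i) px.
      rewrite /e /P /vtail /vsub /vscale => px_i.
      set gx := G (x k) in px_i *; set gy := G (y k).
      have -> : forall p q r, - l k ord0 * (/ t k * (p - gx (lift ord0 i)))
        - / t k * (q - gx ord0) * r = / t k * (- l k ord0 * p - q * r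
        - (- l k ord0 * gx (lift ord0 i) - gx ord0 * r)) by move=> *; ring.
      by rewrite px_i; ring.
    rewrite dotZl dotZr -Rmult_assoc.
    apply: (@Rle_trans _ (/ t k * / t k *
      (2 * (- l k ord0) * G (y k) ord0 * (- dot (l k) (G (y k)))))).
      apply: Rmult_le_compat_l; last exact: (soc_complementarity pol (Ky k)).
      by have := Rinv_0_lt_compat _ tk; nra.
    have -> : / t k * / t k * (2 * - l k ord0 * G (y k) ord0 * - dot (l k) (G (y k)))
        = 2 * - l k ord0 * G (y k) ord0 * c k by rewrite /c; field; lra.
    apply: Rmult_le_compat_l; last exact: HB.
    have := polar_soc pol; have := vnorm_ge0 (vtail (l k)); have := soc_ge0 (Ky k).
    by rewrite -/(y k); nra.
  have := is_lim_seq_unique _ _ lim0.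
  by rewrite (is_lim_seq_unique _ _ (lim_dot lim_e lim_e)) => -[] ->; rewrite sqrt_0.
split=> //.
(* Pairing the parallelism with the tail of Pw gives - l_0 |Pw_r|^2 = Pw_0 <l_r, Pw_r>, and [crit1]
   replaces <l_r, Pw_r> by - l_0 Pw_0. *)
- move: crit1 par; set Pw := jac_r _ _ => crit1 /(congr1 (fun q => dot q (vtail Pw))).
  rewrite dot_recl in crit1; rewrite !dotE vnorm_sqr => par.
  have : Pw ord0 * (l0 ord0 * Pw ord0 + dot (vtail l0) (vtail Pw)) = 0.
    by rewrite crit1; ring.
  by lra.
have lim2 : / 2 * quad (D2f xbar) w0 + dot l0 (fun i => / 2 * quad (D2G xbar i) w0)
    <= / (2 * kappa).
  have : Rbar_le (Finite (/ 2 * quad (D2f xbar) w0 +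
      dot l0 (fun i => / 2 * quad (D2G xbar i) w0))) (Finite (/ (2 * kappa))); last by [].
  apply: is_lim_seq_le lim_S (is_lim_seq_const _) => k.
  by have := abc k; have := c_ge0 k; lra.
have E : dot l0 (fun i => / 2 * quad (D2G xbar i) w0) =
    / 2 * dot l0 (fun i => quad (D2G xbar i) w0) := dotZr _ _ _.
by rewrite E Rinv_mult in lim2; lra.
Qed.

Lemma uniform_growth n m (f : vec n -> R) Df D2f (G : vec n -> vec m.+1) DG D2G
    xbar s kappa lbar :
  C2_with f Df D2f xbar ->
  (forall i, C2_with (fun x => G x i) (fun x => DG x i) (fun x => D2G x i) xbar) ->
  G xbar ord0 = 0 -> 0 <= s ->
  (forall l, KKT Df G DG s xbar (@vzero n) l -> l = lbar) ->
  (forall u, vnorm u = 1 -> dot lbar (jac_r (DG xbar) u) = 0 ->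
     lbar ord0 * (vnorm (vtail (jac_r (DG xbar) u)) ^ 2
                  - jac_r (DG xbar) u ord0 ^ 2) = 0 ->
     / kappa < quad (D2f xbar) u + dot lbar (fun i => quad (D2G xbar i) u)) ->
  exists r, 0 < r /\ forall x y v l,
    vnorm (vsub x xbar) < r -> vnorm (vsub y xbar) < r -> vnorm v < r ->
    KKT Df G DG s x v l -> soc (G y) ->
    f x + dot v (vsub y x) + vnorm (vsub y x) ^ 2 / (2 * kappa) <= f y.
Proof.
move=> C2f C2G G0 s_ge0 uniq_l sosc; apply: NNPP => no_r.
have H k : exists q : vec n * vec n * vec n * vec m.+1,
    let: (x, y, v, l) := q in
    [/\ vnorm (vsub x xbar) <= inv_succ k, vnorm (vsub y xbar) <= inv_succ k,
        vnorm (vsub v (@vzero n)) <= inv_succ k, KKT Df G DG s x v l /\ soc (G y)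
      & f y < f x + dot v (vsub y x) + vnorm (vsub y x) ^ 2 / (2 * kappa)].
  apply: NNPP => no_q; apply: no_r; exists (inv_succ k).
  split=> [|x y v l x_r y_r v_r kkt Ky]; first exact: inv_succ_gt0.
  apply: Rnot_lt_le => lt_f; apply: no_q; exists (x, y, v, l).
  have -> : vsub v (@vzero n) = v by vext.
  by split=> //; apply: Rlt_le.
have [q Hq] := choice_fun H.
pose x k := (q k).1.1.1; pose y k := (q k).1.1.2; pose v k := (q k).1.2.
pose l k := (q k).2.
have {H}Hq k : [/\ vnorm (vsub (x k) xbar) <= inv_succ k,
    vnorm (vsub (y k) xbar) <= inv_succ k,
    vnorm (vsub (v k) (@vzero n)) <= inv_succ k,
    KKT Df G DG s (x k) (v k) (l k) /\ soc (G (y k))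
  & f (y k) < f (x k) + dot (v k) (vsub (y k) (x k))
      + vnorm (vsub (y k) (x k)) ^ 2 / (2 * kappa)].
  by move: (Hq k); rewrite /x /y /v /l; case: (q k) => -[[? ?] ?] ?.
have xx : vlim x xbar by apply: vlim_of_inv_succ => k; case: (Hq k).
have yy : vlim y xbar by apply: vlim_of_inv_succ => k; case: (Hq k).
have vv : vlim v (@vzero n) by apply: vlim_of_inv_succ => k; case: (Hq k).
have kkt k : KKT Df G DG s (x k) (v k) (l k) by case: (Hq k) => _ _ _ [].
pose t k := vnorm (vsub (y k) (x k)); pose w k := vscale (/ t k) (vsub (y k) (x k)).
(* The failed inequality is strict, which excludes y = x and makes the normalised direction w
   meaningful. *)
have t_gt0 k : 0 < t k.
  apply: vnorm_gt0 => yx0; case: (Hq k) => _ _ _ _.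
  by rewrite (vsub_eq0 yx0) (_ : vsub _ _ = @vzero n) ?dot0r ?vnorm0; [lra|vext].
have w1 k : vnorm (w k) = 1.
  have ti := Rinv_0_lt_compat _ (t_gt0 k).
  by rewrite /w vnormZ Rabs_pos_eq -/(t k); [field; have := t_gt0 k|]; lra.
have y_eq k : y k = vadd (x k) (vscale (t k) (w k)).
  rewrite -{1}(vaddBK (x k) (y k)); congr vadd.
  by apply: functional_extensionality => i; rewrite /w /vscale; field; have := t_gt0 k; lra.
have t0 : is_lim_seq t 0.
  rewrite -(vnorm0 n) (_ : @vzero n = vsub xbar xbar); last by vext.
  exact/lim_vnorm/vlimB.
have [M HM] := vlim_bounded (vlimB vv (C2_grad_vlim C2f xx)).
have [k|phi [l0 [ephi ll0]]] := @Bolzano_Weierstrass_vec _ l (s * M).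
  by apply: Rle_trans (KKT_bound (kkt k)) _; apply: Rmult_le_compat_l.
have [k|psi [w0 [epsi ww0]]] := @Bolzano_Weierstrass_vec _ (fun k => w (phi k)) 1.
  by rewrite w1; lra.
have e k : (k <= phi (psi k))%coq_nat := Nat.le_trans _ _ _ (epsi k) (ephi _).
have {}ll0 := vlim_extraction epsi ll0.
have l0_eq : l0 = lbar.
  apply: uniq_l.
  exact: (KKT_limit C2f C2G (fun k => kkt (phi (psi k)))
    (vlim_extraction e xx) (vlim_extraction e vv) ll0).
have [|||crit1 crit2] := @growth_failure_direction _ _ f Df D2f G DG D2G xbar s kappa
    _ _ _ (fun k => t (phi (psi k))) _ w0 l0 C2f C2G G0 (vlim_extraction e xx) _
    (lim_extraction e t0) ww0 ll0 (fun k => kkt (phi (psi k))).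
- by move=> k; apply: t_gt0.
- by move=> k; rewrite -y_eq; case: (Hq (phi (psi k))) => _ _ _ [].
- move=> k; rewrite -y_eq; case: (Hq (phi (psi k))) => _ _ _ _.
  set j := phi _; rewrite -/(t j) (_ : vsub (y j) (x j) = vscale (t j) (w j)).
    by rewrite dotZr.
  by rewrite {1}y_eq vsubDK.
have w01 : vnorm w0 = 1.
  have := is_lim_seq_unique _ _ (lim_vnorm ww0).
  rewrite (Lim_seq_ext _ (fun=> 1)); last by move=> k; apply: w1.
  by rewrite Lim_seq_const => -[].
by rewrite l0_eq in crit1 crit2 *; have := sosc w0 w01 crit1 crit2; lra.
Qed.

(** * From growth to tilt stability *)

Lemma vdist0 n (x : vec n) : vnorm (vsub x x) = 0.
Proof. by rewrite (_ : vsub x x = @vzero n) ?vnorm0 //; vext. Qed.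

(** Fermat rule: as x lies strictly inside the ball, the ball constraint is inactive near x. *)
Lemma argmin_reg_normal n (f : vec n -> R) (C : vec n -> Prop) xbar gamma v x G :
  argminM f C xbar gamma v x -> vnorm (vsub x xbar) < gamma -> has_grad f x G ->
  reg_normal C x (vsub v G).
Proof.
move=> [Cx [_ x_min]] x_lt gf; split=> // eps eps_gt0.
have [r [r_gt0 Hr]] := gf eps eps_gt0.
exists (Rmin r (gamma - vnorm (vsub x xbar))); split; first by apply: Rmin_pos; lra.
move=> y Cy yx.
have := Rmin_l r (gamma - vnorm (vsub x xbar)).
have := Rmin_r r (gamma - vnorm (vsub x xbar)) => ? ?.
have y_le : vnorm (vsub y xbar) <= gamma by have := vdist_triangle y x xbar; lra.
have := x_min y Cy y_le; have := Hr (vsub y x) ltac:(lra).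
by rewrite vaddBK => /Rabs_le_between; rewrite !dotE; lra.
Qed.

(* Adding the growth inequalities at two tilted minimizers gives
   [|x1 - x2|^2 / kappa <= <v1 - v2, x1 - x2>]. *)
Lemma tilt_stable_of_growth n (f : vec n -> R) Df (C : vec n -> Prop) xbar kappa r :
  0 < kappa -> 0 < r -> C xbar ->
  (forall x, vnorm (vsub x xbar) < r -> has_grad f x (Df x)) ->
  (forall s x, vlim s x -> (forall k, C (s k)) -> vnorm (vsub x xbar) < r -> C x) ->
  (forall y, vnorm (vsub y xbar) < r -> C y ->
     f xbar + vnorm (vsub y xbar) ^ 2 / (2 * kappa) <= f y) ->
  (forall x y v, vnorm (vsub x xbar) < r -> vnorm (vsub y xbar) < r -> vnorm v < r ->
     reg_normal C x (vsub v (Df x)) -> C y ->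
     f x + dot v (vsub y x) + vnorm (vsub y x) ^ 2 / (2 * kappa) <= f y) ->
  tilt_stable f C xbar kappa.
Proof.
move=> kappa_gt0 r_gt0 Cxbar gf clC grow0 grow.
(* Halving r puts the closed ball of radius gamma inside the open ball where growth is available. *)
pose gamma := r / 2; have gamma_gt0 : 0 < gamma by rewrite /gamma; lra.
have gamma_lt : gamma < r by rewrite /gamma; lra.
pose delta := Rmin r (gamma / (2 * kappa)).
have delta_gt0 : 0 < delta by apply: Rmin_pos => //; apply: Rdiv_lt_0_compat; lra.
have ik := Rinv_0_lt_compat _ kappa_gt0.
have divk a : a / (2 * kappa) = a * / kappa / 2 by field; lra.
(* Growth at xbar gives |x - xbar| <= 2 kappa |v|, and delta makes this less than gamma. Tilted
   minimizers are therefore interior and yield regular normals. *)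
have near v x : vnorm v < delta -> argminM f C xbar gamma v x ->
    vnorm (vsub x xbar) < gamma.
  move=> v_lt [Cx [x_le x_min]].
  have := grow0 x ltac:(lra) Cx.
  have := x_min xbar Cxbar; rewrite vdist0 => /(_ ltac:(lra)).
  have := dot_le_vnorm v (vsub x xbar); rewrite !dotE => le1 le2 le3.
  have v_lt2 : 2 * kappa * vnorm v < gamma.
    have := Rmin_r r (gamma / (2 * kappa)); rewrite -/delta => ?.
    have /(Rmult_lt_compat_l (2 * kappa)) : vnorm v < gamma / (2 * kappa) by lra.
    rewrite (_ : 2 * kappa * (gamma / (2 * kappa)) = gamma); last by field; lra.
    by apply; lra.
  apply: Rnot_le_lt => x_ge.
  have : vnorm (vsub x xbar) ^ 2 / (2 * kappa) <= vnorm v * vnorm (vsub x xbar) by lra.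
  move/(Rmult_le_compat_l (2 * kappa) _ _ ltac:(lra)).
  rewrite (_ : 2 * kappa * (_ / _) = vnorm (vsub x xbar) ^ 2); last by field; lra.
  by nra.
have lip v1 v2 x1 x2 : vnorm v1 < delta -> vnorm v2 < delta ->
    argminM f C xbar gamma v1 x1 -> argminM f C xbar gamma v2 x2 ->
    vnorm (vsub x1 x2) <= kappa * vnorm (vsub v1 v2).
  move=> v1_lt v2_lt M1 M2.
  have x1_lt := near _ _ v1_lt M1; have x2_lt := near _ _ v2_lt M2.
  have delta_le := Rmin_l r (gamma / (2 * kappa)); rewrite -/delta in delta_le.
  have N1 := argmin_reg_normal M1 x1_lt (gf x1 ltac:(lra)).
  have N2 := argmin_reg_normal M2 x2_lt (gf x2 ltac:(lra)).
  have := grow x1 x2 v1 ltac:(lra) ltac:(lra) ltac:(lra) N1 M2.1.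
  have := grow x2 x1 v2 ltac:(lra) ltac:(lra) ltac:(lra) N2 M1.1.
  rewrite (vnormBC x2 x1) !divk => g1 g2.
  have := dot_le_vnorm (vsub v1 v2) (vsub x1 x2).
  set N := vnorm (vsub x1 x2) in g1 g2 *; have N_ge0 : 0 <= N := vnorm_ge0 _.
  move: g1 g2; rewrite !dotE => g1 g2 cs.
  have : N ^ 2 * / kappa <= vnorm (vsub v1 v2) * N by lra.
  move/(Rmult_le_compat_l kappa _ _ (Rlt_le _ _ kappa_gt0)).
  rewrite (_ : kappa * (N ^ 2 * / kappa) = N ^ 2); last by field; lra.
  have := vnorm_ge0 (vsub v1 v2); case: (Req_dec N 0) => [->|]; nra.
have exM v : exists x, argminM f C xbar gamma v x.
  have [||||x [[Cx x_le] x_min]] := @vec_minimum_exists n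
    (fun x => C x /\ vnorm (vsub x xbar) <= gamma) (fun x => f x - dot v x)
    (vnorm xbar + gamma) xbar.
  - move=> s x sx Hs.
    have x_le : vnorm (vsub x xbar) <= gamma.
      have : Rbar_le (Finite (vnorm (vsub x xbar))) (Finite gamma); last by [].
      apply: is_lim_seq_le (lim_vnorm (vlimB sx (vlim_const xbar)))
        (is_lim_seq_const _) => k.
      by case: (Hs k).
    split=> //; apply: clC sx _ _; last lra.
    by move=> k; case: (Hs k).
  - move=> x [_ x_le]; rewrite -(vaddBK xbar x).
    by apply: Rle_trans (vnormD _ _) _; lra.
  - by rewrite vdist0; split=> //; lra.
  - move=> s x sx _ [Cx x_le]; apply: is_lim_seq_minus'.
      by apply: (has_grad_lim _ sx); apply: gf; lra.
    exact: lim_dot (vlim_const v) sx.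
  by exists x; split=> //; split=> // y Cy y_le; apply: x_min.
split=> //; exists gamma; split=> //.
have v0 : vnorm (@vzero n) < delta by rewrite vnorm0.
have uniq v x x' : vnorm v < delta -> argminM f C xbar gamma v x ->
    argminM f C xbar gamma v x' -> x' = x.
  move=> v_lt M1 M2; have := lip _ _ _ _ v_lt v_lt M2 M1.
  rewrite vdist0 Rmult_0_r => le0; apply/vsub_eq0/vnorm_eq0.
  by have := vnorm_ge0 (vsub x' x); lra.
split.
  exists delta; split=> //; split=> // v v_lt.
  by have [x Mx] := exM v; exists x; split=> // x'; apply: uniq v_lt Mx.
have M0 : argminM f C xbar gamma (@vzero n) xbar.
  split=> //; split=> [|y Cy y_le]; first by rewrite vdist0; lra.
  have := grow0 y ltac:(lra) Cy; rewrite !dot0l divk.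
  by have := vnorm_ge0 (vsub y xbar); nra.
by move=> x; split=> [Mx|-> //]; apply: uniq v0 M0 Mx.
Qed.

(** * Multipliers from the error bound, and uniqueness at xbar *)

Definition error_bound {n p} (K : vec p -> Prop) (G : vec n -> vec p) (xbar : vec n)
    (s : R) : Prop :=
  exists r, 0 < r /\ forall y q, vnorm (vsub y xbar) < r -> K q ->
    exists z, K (G z) /\ vnorm (vsub y z) <= s * vnorm (vsub (G y) q).

Lemma KKT_of_reg_normal n m Df (G : vec n -> vec m.+1) DG D2G xbar s :
  (forall i, C2_with (fun x => G x i) (fun x => DG x i) (fun x => D2G x i) xbar) ->
  0 <= s -> error_bound soc G xbar s ->
  exists r, 0 < r /\ forall x v, vnorm (vsub x xbar) < r ->
    reg_normal (fun y => soc (G y)) x (vsub v (Df x)) -> exists l, KKT Df G DG s x v l.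
Proof.
move=> C2G s_ge0 [r1 [r1_gt0 errb]].
have [i|i d d' Hd led x ?|r2 [r2_gt0 gG]] := @ord_common_radius m.+1 (fun i r =>
  forall x, vnorm (vsub x xbar) < r -> has_grad (fun y => G y i) x (DG x i)).
- by have [r [r_gt0 Hr]] := C2G i; exists r; split=> // x /Hr [].
- by apply: Hd; lra.
(* With r1 / 2, the ball of radius r1 / 2 around x stays in the ball of radius r1 around xbar. *)
exists (Rmin (r1 / 2) r2); split; first by apply: Rmin_pos; lra.
move=> x v x_lt nv; have := Rmin_l (r1 / 2) r2; have := Rmin_r (r1 / 2) r2 => ? ?.
have [i||y q y_lt Kq|l [pol compl l_le grad]] := @normal_multiplier _ _ soc G (DG x) x
  (vsub v (Df x)) s (r1 / 2) (@soc_convex_cone m) (@soc_closed m) _ _ s_ge0 _ nv.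
- by apply: gG; lra.
- by lra.
- by apply: errb => //; have := vdist_triangle y x xbar; lra.
by exists l; split=> //; case: nv.
Qed.

Lemma KKT_of_lim_normal n m f Df D2f (G : vec n -> vec m.+1) DG D2G xbar s :
  C2_with f Df D2f xbar ->
  (forall i, C2_with (fun x => G x i) (fun x => DG x i) (fun x => D2G x i) xbar) ->
  0 <= s -> error_bound soc G xbar s ->
  lim_normal (fun y => soc (G y)) xbar (vopp (Df xbar)) ->
  exists l, KKT Df G DG s xbar (@vzero n) l.
Proof.
move=> C2f C2G s_ge0 errb [_ [xs [vs [nvs [/vlim_seq_cv xx /vlim_seq_cv vv]]]]].
have [r [r_gt0 Hr]] := KKT_of_reg_normal Df C2G s_ge0 errb.
have [N HN] := lim_eventually (vlim_dist xx) r_gt0.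
have eN k : (k <= k + N)%coq_nat by apply: Nat.le_add_r.
(* The tilt v k is chosen so that v k - Df (x k) is the given regular normal; it tends to 0. *)
pose x k := xs (k + N)%coq_nat; pose v k := vadd (vs (k + N)%coq_nat) (Df (x k)).
have xx' : vlim x xbar := vlim_extraction eN xx.
have vv' : vlim v (@vzero n).
  have -> : @vzero n = vadd (vopp (Df xbar)) (Df xbar) by vext.
  exact: vlimD (vlim_extraction eN vv) (C2_grad_vlim C2f xx').
have H k : exists l, KKT Df G DG s (x k) (v k) l.
  apply: Hr.
    have := HN (k + N)%coq_nat (Nat.le_add_l _ _).
    by rewrite Rminus_0_r Rabs_pos_eq //; apply: vnorm_ge0.
  have -> : vsub (v k) (Df (x k)) = vs (k + N)%coq_nat by rewrite /v; vext.
  exact: nvs.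
have [l kkt] := choice_fun H.
have [M HM] := vlim_bounded (vlimB vv' (C2_grad_vlim C2f xx')).
have [k|phi [l0 [ephi ll0]]] := @Bolzano_Weierstrass_vec _ l (s * M).
  by apply: Rle_trans (KKT_bound (kkt k)) _; apply: Rmult_le_compat_l.
exists l0.
exact: (KKT_limit C2f C2G (fun k => kkt (phi k))
  (vlim_extraction ephi xx') (vlim_extraction ephi vv') ll0).
Qed.

(** As G vanishes at xbar, the difference quotients are positive multiples of feasible values of G
    and stay in the closed cone. *)
Lemma tangent_linearized n m (G : vec n -> vec m.+1) DG D2G xbar u :
  (forall i, C2_with (fun x => G x i) (fun x => DG x i) (fun x => D2G x i) xbar) ->
  G xbar = @vzero m.+1 -> tangent (fun y => soc (G y)) xbar u ->
  soc (jac_r (DG xbar) u).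
Proof.
move=> C2G G0 [t [us [t_gt0 [/is_lim_seq_Reals t0 [/vlim_seq_cv uu Ku]]]]].
have [_ KZ _] := @soc_convex_cone m.
apply: (@soc_closed m (fun k => vscale (/ t k) (G (vadd xbar (vscale (t k) (us k)))))).
  move=> i; apply: is_lim_seq_ext
    (diff_quotient_seq (C2G i) (vlim_const xbar) t0 t_gt0 uu) => k.
  by rewrite G0 /vscale /vzero Rminus_0_r /Rdiv Rmult_comm.
by move=> k; apply: KZ => //; apply/Rlt_le/Rinv_0_lt_compat.
Qed.

Lemma adjZ n p (A : 'I_p -> vec n) a l : adj A (vscale a l) = vscale a (adj A l).
Proof. by apply: dot_inj => h; rewrite dotZl !dot_adj dotZl. Qed.

(* Complementarity with the critical direction forces the multiplier onto the ray
   of [\hat q], and the norm of the gradient fixes its position there; when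
   [Df xbar = 0] the coefficient is [0] (even if it reads [0 / 0]) and the norm
   bound gives [l = 0]. *)
Lemma KKT_multiplier_unique n m Df (G : vec n -> vec m.+1) DG s xbar u l :
  KKT Df G DG s xbar (@vzero n) l -> dot (Df xbar) u = 0 ->
  let q := jac_r (DG xbar) u in soc q -> q <> @vzero m.+1 ->
  let qhat := vcons (- q ord0) (vtail q) in
  l = vscale (vnorm (Df xbar) / vnorm (adj (DG xbar) qhat)) qhat.
Proof.
move=> [_ pol _ l_le grad] Du q Kq q_neq0 qhat.
have sub0 : vsub (@vzero n) (Df xbar) = vscale (-1) (Df xbar) by vext.
rewrite sub0 vnormZ Rabs_Ropp Rabs_R1 Rmult_1_l in l_le.
have lq : dot l q = 0 by rewrite /q -dot_adj -grad sub0 dotZl Du; ring.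
have par := soc_orthogonal_parallel pol Kq lq.
(* A vector of the cone with zero scalar component vanishes, so q_0 is a legitimate denominator for
   the coefficient [al]. *)
have q0_gt0 : 0 < q ord0.
  case: (soc_ge0 Kq) => // q00; case: q_neq0; rewrite (vec_eta q) -q00.
  have -> : vtail q = @vzero m.
    apply: vnorm_eq0; move: Kq; rewrite /soc -q00.
    by have := vnorm_ge0 (vtail q); lra.
  apply: functional_extensionality => i.
  by case: (unliftP ord0 i) => [j ->|->]; rewrite ?vconsS ?vcons0.
pose al := - l ord0 / q ord0.
have l_eq : l = vscale al qhat.
  apply: functional_extensionality => i; rewrite /vscale /qhat /al.
  case: (unliftP ord0 i) => [j ->|->]; rewrite ?vconsS ?vcons0; last by field; lra.
  have := congr1 (fun z => z j) par; rewrite /vscale /vtail => par_j.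
  apply: (Rmult_eq_reg_l (q ord0)); last lra.
  by rewrite -par_j; field; lra.
have al_ge0 : 0 <= al.
  apply: Rmult_le_pos; last by apply/Rlt_le/Rinv_0_lt_compat.
  by have := polar_soc pol; have := vnorm_ge0 (vtail l); lra.
have nDf : vnorm (Df xbar) = al * vnorm (adj (DG xbar) qhat).
  have := congr1 vnorm grad; rewrite sub0 {1}l_eq adjZ !vnormZ.
  by rewrite Rabs_Ropp Rabs_R1 Rmult_1_l Rabs_pos_eq.
have [Df0|Df_neq0] := Req_dec (vnorm (Df xbar)) 0.
  rewrite Df0 Rmult_0_r in l_le; rewrite Df0.
  rewrite (@vnorm_eq0 _ l); last by have := vnorm_ge0 l; lra.
  by rewrite /Rdiv Rmult_0_l; vext.
rewrite {1}l_eq; congr vscale; rewrite nDf; field => n0.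
by apply: Df_neq0; rewrite nDf n0 Rmult_0_r.
Qed.

Lemma tilt_stable_soc n m (f : vec n -> R) Df D2f (G : vec n -> vec m.+1) DG D2G
    xbar s kappa lbar :
  C2_with f Df D2f xbar ->
  (forall i, C2_with (fun x => G x i) (fun x => DG x i) (fun x => D2G x i) xbar) ->
  G xbar ord0 = 0 -> 0 <= s -> error_bound soc G xbar s -> 0 < kappa ->
  KKT Df G DG s xbar (@vzero n) lbar ->
  (forall l, KKT Df G DG s xbar (@vzero n) l -> l = lbar) ->
  (forall u, vnorm u = 1 -> dot lbar (jac_r (DG xbar) u) = 0 ->
     lbar ord0 * (vnorm (vtail (jac_r (DG xbar) u)) ^ 2
                  - jac_r (DG xbar) u ord0 ^ 2) = 0 ->
     / kappa < quad (D2f xbar) u + dot lbar (fun i => quad (D2G xbar i) u)) ->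
  tilt_stable f (fun x => soc (G x)) xbar kappa.
Proof.
move=> C2f C2G G0 s_ge0 errb kappa_gt0 kkt uniq sosc.
have [r1 [r1_gt0 grow]] := uniform_growth C2f C2G G0 s_ge0 uniq sosc.
have [r2 [r2_gt0 mult]] := KKT_of_reg_normal Df C2G s_ge0 errb.
have [r3 [r3_gt0 gf]] := C2f.
have [i|i d d' Hd led x ?|r4 [r4_gt0 gG]] := @ord_common_radius m.+1 (fun i r =>
  forall x, vnorm (vsub x xbar) < r -> has_grad (fun y => G y i) x (DG x i)).
- by have [r [r_gt0 Hr]] := C2G i; exists r; split=> // x /Hr [].
- by apply: Hd; lra.
pose r := Rmin (Rmin r1 r2) (Rmin r3 r4).
have r_gt0 : 0 < r by do ?apply: Rmin_pos.
have le1 : r <= Rmin r1 r2 := Rmin_l _ _.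
have le2 : r <= Rmin r3 r4 := Rmin_r _ _.
have := Rmin_l r1 r2; have := Rmin_r r1 r2.
have := Rmin_l r3 r4; have := Rmin_r r3 r4 => ? ? ? ?.
apply: (@tilt_stable_of_growth _ f Df _ _ _ r) => //.
- exact: KKT_feasible kkt.
- by move=> x x_r; have [|] := gf x; first lra.
- move=> y x yx Ky x_r; apply: soc_closed _ Ky.
  by apply: (has_grad_vlim _ yx) => i; apply: gG; lra.
(* xbar is known to be stationary only in the limiting sense, so growth there comes from the pair
   (xbar, 0) with multiplier lbar instead of a regular normal. *)
- move=> y y_r Ky.
  have := grow xbar y (@vzero n) lbar; rewrite vdist0 vnorm0 dot0l Rplus_0_r.
  by apply=> //; lra.
- move=> x y v x_r y_r v_r nv Ky.
  have [l kktl] := mult x v ltac:(lra) nv.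
  by apply: grow kktl Ky; lra.
Qed.

(** * Translation of problem (P) into the cone setting *)

Lemma is_inf_exists (E : R -> Prop) b t0 : (forall t, E t -> b <= t) -> E t0 ->
  exists a, is_inf E a.
Proof.
move=> Eb Et0.
have [||a [a_ub a_lub]] := completeness (fun t => E (- t)).
- by exists (- b) => t /Eb; lra.
- by exists (- t0); rewrite Ropp_involutive.
exists (- a); split=> [t Et|c Ec].
  by have := a_ub (- t); rewrite Ropp_involutive => /(_ Et); lra.
have : a <= - c by apply: a_lub => t /Ec; lra.
by lra.
Qed.

Lemma in_Gamma_soc n m (g0 : vec n -> R) (gr : vec n -> vec m) :
  in_Gamma g0 gr = (fun x => soc (vcons (g0 x) (gr x))).
Proof.
apply: functional_extensionality => x.
by rewrite /in_Gamma /in_Q /soc vtail_cons vcons0.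
Qed.

(* The factor [2] leaves room for the infimum in the distance to [Gamma] not to be
   attained. *)
Lemma error_bound_MSCQ n m (g0 : vec n -> R) (gr : vec n -> vec m) xbar sigma :
  in_Gamma g0 gr xbar -> MSCQ g0 gr xbar sigma ->
  error_bound soc (fun x => vcons (g0 x) (gr x)) xbar (2 * sigma).
Proof.
move=> Gx [sigma_gt0 [r [r_gt0 Hr]]]; exists r; split=> // y q y_r Kq.
have D_ge0 := vnorm_ge0 (vsub (vcons (g0 y) (gr y)) q).
(* Positivity of D is what makes 2 sigma D exceed the distance; when D = 0, y itself is feasible. *)
case: D_ge0 => [D_gt0|D0]; last first.
  have e : vcons (g0 y) (gr y) = q by apply/vsub_eq0/vnorm_eq0.
  by exists y; rewrite vdist0 -D0 e; split=> //; lra.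
have [||d1 inf1] := @is_inf_exists
  (fun t => exists z, in_Gamma g0 gr z /\ t = vnorm (vsub y z)) 0 (vnorm (vsub y xbar)).
- by move=> t [z [_ ->]]; apply: vnorm_ge0.
- by exists xbar.
pose E t := exists q0 (qr : vec m), in_Q q0 qr /\
  t = sqrt ((g0 y - q0) ^ 2 + (vnorm (vsub (gr y) qr)) ^ 2).
have E_D : E (vnorm (vsub (vcons (g0 y) (gr y)) q)).
  exists (q ord0), (vtail q); split=> //; congr sqrt.
  rewrite dot_recl vnorm_sqr (_ : vtail _ = vsub (gr y) (vtail q)).
    by rewrite /vsub vcons0; ring.
  by apply: functional_extensionality => j; rewrite /vtail /vsub vconsS.
have [||d2 inf2] := @is_inf_exists E 0 (vnorm (vsub (vcons (g0 y) (gr y)) q)) => //.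
  by move=> t [q0 [qr [_ ->]]]; apply: sqrt_pos.
have d12 := Hr y y_r d1 d2 inf1 inf2.
have d2_le := inf2.1 _ E_D.
apply: NNPP => no_z.
(* If no feasible z is that close, then 2 sigma D <= d1 <= sigma d2 <= sigma D, which is absurd. *)
suff : 2 * sigma * vnorm (vsub (vcons (g0 y) (gr y)) q) <= d1 by nra.
apply: inf1.2 => t [z [Gz ->]]; apply: Rnot_lt_le => lt_z.
apply: no_z; exists z; split; last exact: Rlt_le.
by rewrite in_Gamma_soc in Gz.
Qed.

Lemma jac_cons n m (a : vec n) (A : 'I_m -> vec n) u :
  jac_r (vcons a A) u = vcons (dot a u) (jac_r A u).
Proof.
apply: functional_extensionality => i.
by case: (unliftP ord0 i) => [j ->|->]; rewrite /jac_r ?vconsS ?vcons0.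
Qed.

Lemma gstar_ghat_adj n m (a : vec n) (A : 'I_m -> vec n) u :
  gstar_ghat a A u = adj (vcons a A) (vcons (- dot a u) (jac_r A u)).
Proof.
apply: functional_extensionality => j.
rewrite /gstar_ghat /adj big_ord_recl !vcons0; congr (_ + _).
by apply: eq_bigr => i _; rewrite !vconsS.
Qed.

Lemma lam_cons n m (d a : vec n) (A : 'I_m -> vec n) u :
  vcons (lam0 d a A u) (lamr d a A u) =
  vscale (vnorm d / vnorm (adj (vcons a A) (vcons (- dot a u) (jac_r A u))))
    (vcons (- dot a u) (jac_r A u)).
Proof.
rewrite -gstar_ghat_adj; apply: functional_extensionality => i.
by rewrite /vscale; case: (unliftP ord0 i) => [j ->|->]; rewrite ?vconsS ?vcons0.
Qed.

Lemma quad_lagrangian n m (A B : mat n) (D : 'I_m -> mat n) l0 (lr : vec m) u :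
  quad (fun i j => A i j + l0 * B i j + \big[Rplus/0]_(k < m) (lr k * D k i j)) u =
  quad A u + dot (vcons l0 lr) (fun i => quad (vcons B D i) u).
Proof.
have quadD (X Y : mat n) : quad (fun i j => X i j + Y i j) u = quad X u + quad Y u.
  rewrite /quad -big_split; apply: eq_bigr => i _ /=.
  by rewrite -big_split; apply: eq_bigr => j _ /=; ring.
have quadS c (X : mat n) : quad (fun i j => c * X i j) u = c * quad X u.
  rewrite /quad -sumR_scal; apply: eq_bigr => i _.
  by rewrite -sumR_scal; apply: eq_bigr => j _; ring.
have quad_sum : quad (fun i j => \big[Rplus/0]_(k < m) (lr k * D k i j)) u =
    \big[Rplus/0]_(k < m) (lr k * quad (D k) u).
  transitivity (\big[Rplus/0]_(k < m) quad (fun i j => lr k * D k i j) u); last first.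
    by apply: eq_bigr => k _.
  rewrite /quad [RHS]exchange_big; apply: eq_bigr => i _ /=.
  rewrite [RHS]exchange_big; apply: eq_bigr => j _ /=.
  rewrite Rmult_assoc (Rmult_comm _ (u j)) -Rmult_assoc.
  by rewrite -sumR_scal; apply: eq_bigr => k _; ring.
rewrite !quadD quadS quad_sum dot_recl !vcons0 Rplus_assoc; congr (_ + (_ + _)).
by apply: eq_bigr => k _; rewrite /vtail !vconsS.
Qed.

Theorem theorem4p3 (n m : nat)
  (f : vec n -> R) (Df : vec n -> vec n) (D2f : vec n -> mat n)
  (g0 : vec n -> R) (Dg0 : vec n -> vec n) (D2g0 : vec n -> mat n)
  (gr : vec n -> vec m) (Dgr : vec n -> 'I_m -> vec n) (D2gr : vec n -> 'I_m -> mat n)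
  (xbar ubar : vec n) (sigma kappa : R) :
  (0 < n)%N -> (0 < m)%N ->
  C2_with f Df D2f xbar ->
  C2_with g0 Dg0 D2g0 xbar ->
  (forall i, C2_with (fun x => gr x i) (fun x => Dgr x i) (fun x => D2gr x i) xbar) ->
  g0 xbar = 0 -> (forall i, gr xbar i = 0) ->
  (* stationarity: - grad f(xbar) in the limiting normal cone to Gamma *)
  lim_normal (in_Gamma g0 gr) xbar (vopp (Df xbar)) ->
  MSCQ g0 gr xbar sigma ->
  critical_cone (in_Gamma g0 gr) xbar (vopp (Df xbar)) ubar ->
  ~ (dot (Dg0 xbar) ubar = 0 /\ forall i, dot (Dgr xbar i) ubar = 0) ->
  0 < kappa ->
  let l0 := lam0 (Df xbar) (Dg0 xbar) (Dgr xbar) ubar in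
  let lr := lamr (Df xbar) (Dg0 xbar) (Dgr xbar) ubar in
  let H : mat n := fun i j => D2f xbar i j + l0 * D2g0 xbar i j
                     + \big[Rplus/0]_(k < m) (lr k * D2gr xbar k i j) in
  let adm (u : vec n) : Prop :=
      vnorm u = 1 /\
      l0 * dot (Dg0 xbar) u + dot lr (jac_r (Dgr xbar) u) = 0 /\
      l0 * ((vnorm (jac_r (Dgr xbar) u)) ^ 2 - (dot (Dg0 xbar) u) ^ 2) = 0 in
  (forall u, adm u -> 1 / kappa < quad H u) ->
  tilt_stable f (in_Gamma g0 gr) xbar kappa /\
  (forall b, 0 <= b -> (forall u, adm u -> 1 / quad H u <= b) ->
     tilt_le f (in_Gamma g0 gr) xbar b).
Proof.
move=> _ _ C2f C2g0 C2gr g00 gr0 stat mscq [tan_u crit_u] jac_u kappa_gt0 l0 lr H adm sosc.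
pose G x := vcons (g0 x) (gr x); pose DG x := vcons (Dg0 x) (Dgr x).
pose D2G x := vcons (D2g0 x) (D2gr x).
have C2G i : C2_with (fun x => G x i) (fun x => DG x i) (fun x => D2G x i) xbar.
  by rewrite /G /DG /D2G /vcons; case: (unlift ord0 i) => [j|] /=; [apply: C2gr|].
have Gxbar : G xbar = @vzero m.+1.
  apply: functional_extensionality => i.
  by case: (unliftP ord0 i) => [j ->|->]; rewrite /G ?vconsS ?vcons0.
have feas : in_Gamma g0 gr xbar by case: stat.
have errb := error_bound_MSCQ feas mscq.
have s_ge0 : 0 <= 2 * sigma by case: mscq; lra.
rewrite in_Gamma_soc in stat tan_u *.
have Kq := tangent_linearized C2G Gxbar tan_u.
have q_neq0 : jac_r (DG xbar) ubar <> @vzero m.+1.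
  rewrite /DG jac_cons => q0; apply: jac_u; split=> [|i].
    by have := congr1 (fun q => q ord0) q0; rewrite vcons0.
  by have := congr1 (fun q => q (lift ord0 i)) q0; rewrite vconsS.
have Du : dot (Df xbar) ubar = 0 by move: crit_u; rewrite dotNl; lra.
have uniq l : KKT Df G DG (2 * sigma) xbar (@vzero n) l -> l = vcons l0 lr.
  move=> kkt; rewrite (KKT_multiplier_unique kkt Du Kq q_neq0) /l0 /lr lam_cons.
  by rewrite /DG jac_cons vcons0 vtail_cons.
have [l kkt] := KKT_of_lim_normal C2f C2G s_ge0 errb stat.
have kktbar : KKT Df G DG (2 * sigma) xbar (@vzero n) (vcons l0 lr) by rewrite -(uniq l kkt).
(* The modulus is left free: the kappa of the statement gives the first claim, and b + eps / 2 the
   second. *)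
have stable k : 0 < k -> (forall u, adm u -> / k < quad H u) ->
    tilt_stable f (fun x => soc (G x)) xbar k.
  move=> k_gt0 sosck.
  apply: (tilt_stable_soc C2f C2G _ s_ge0 errb k_gt0 kktbar uniq).
    by rewrite Gxbar.
  move=> u u1; rewrite /DG jac_cons vtail_cons vcons0 dot_recl !vtail_cons !vcons0.
  move=> crit1 crit2; rewrite -quad_lagrangian; apply: sosck.
  by split.
have {}sosc u : adm u -> / kappa < quad H u by move/sosc; rewrite /Rdiv Rmult_1_l.
split=> [|b b_ge0 Hb eps eps_gt0]; first exact: stable.
have pos u : adm u -> 0 < quad H u.
  by move/sosc; have := Rinv_0_lt_compat _ kappa_gt0; lra.
(* Adding eps / 2 makes the modulus positive even if b = 0, turns 1 / quad H u <= b into the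
   required strict inequality, and stays below b + eps. *)
have [|u adm_u|_ [gamma [gamma_gt0 [[delta [delta_gt0 lip]] _]]]] := stable (b + eps / 2).
- by lra.
- have Hu := pos u adm_u; have := Hb u adm_u; rewrite /Rdiv Rmult_1_l => le_b.
  rewrite -(Rinv_inv (quad H u)); apply: Rinv_lt_contravar; last by lra.
  by apply: Rmult_lt_0_compat; [exact: Rinv_0_lt_compat|lra].
exists gamma, (b + eps / 2), delta.
by do ![split=> //]; lra.
Qed.
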